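(* Let $F$ be a field and let $A$ and $B$ be two semi-simple $F$-algebras. Realize $B$ as $\prod_{j=1}^r \mathrm{End}_{\Delta_j}(V_j)$, where, for each $j$, $\Delta_j$ is a division $F$-algebra and $V_j$ is a right $\Delta_j$-module. Write $A=\prod_{i=1}^s A_i$ as the product of simple $F$-algebras. (1) For each $j$, write the maximal semi-simple quotient $$(\Delta_j\otimes_F A^{\mathrm{o}})^{ss}=\prod_{k=1}^{t_j}\mathrm{Mat}_{m_{jk}}(D_{jk})$$ of $\Delta_j\otimes_F A^{\mathrm{o}}$ as the product of simple factors (the Wedderburn decomposition, with each $D_{jk}$ a division $F$-algebra). Then the set $\mathrm{Hom}_{F\text{-alg}}(A,B)$ is non-empty if and only if there are non-negative integers $x_{jk}$, for $j=1,\dots,r$ and $k=1,\dots,t_j$, such that (a) $\sum_{k=1}^{t_j}x_{jk}=\dim_{\Delta_j}V_j$ for all $j$, and (b) for all $j,k$, one has $\dfrac{m_{jk}[D_{jk}:F]}{[\Delta_j:F]}\ \Big|\ x_{jk}$. (2) For each $j,i$, write the maximal semi-simple quotient $$(\Delta_j\otimes_F A_i^{\mathrm{o}})^{ss}=\prod_{k=1}^{t_{ji}}\mathrm{Mat}_{m_{jik}}(D_{jik})$$ of $\Delta_j\otimes_F A_i^{\mathrm{o}}$ as the product of simple factors (with each $D_{jik}$ a division $F$-algebra). Then the set $\mathrm{Hom}^*_{F\text{-alg}}(A,B)$ is non-empty if and only if there are non-negative integers $x_{jik}$, for $j=1,\dots,r$, $i=1,\dots,s$ and $k=1,\dots,t_{ji}$,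 such that (a) $\sum_{i,k}x_{jik}=\dim_{\Delta_j}V_j$ for all $j$, (b) for all $j,i,k$, one has $\dfrac{m_{jik}[D_{jik}:F]}{[\Delta_j:F]}\ \Big|\ x_{jik}$, and (c) for all $i$, the sum $\sum_{j,k}x_{jik}$ is positive.
   Context: All $F$-algebras are finite-dimensional over the (arbitrary) field $F$, and all modules are finite-dimensional over $F$. $F$-algebra homomorphisms send the identity to the identity. $\mathrm{Hom}_{F\text{-alg}}(A,B)$ is the set of all $F$-algebra homomorphisms $A\to B$, and $\mathrm{Hom}^*_{F\text{-alg}}(A,B)$ is the subset of embeddings (injective homomorphisms). $A^{\mathrm{o}}$ is the opposite algebra of $A$. For an $F$-algebra $C$, $C^{ss}:=C/\mathrm{rad}(C)$, where $\mathrm{rad}(C)$ is the Jacobson radical. $[D:F]$ denotes $\dim_F D$. Note that $\Delta_j$ embeds in $\mathrm{Mat}_{m_{jk}}(D_{jk})$ and in $\mathrm{Mat}_{m_{jik}}(D_{jik})$, so the quotients in the conditions (b) are positive integers. *)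

(* Defs.v *)
From HB Require Import structures.
From mathcomp Require Import all_boot all_order all_algebra all_field.
From mathcomp Require Import boolp.

Set Implicit Arguments.
Unset Strict Implicit.
Unset Printing Implicit Defensive.

Import GRing.Theory.

Local Open Scope ring_scope.

(* Conventions.
   - Finite-dimensional F-algebras are the library's [falgType F]; as usual
     there, such an algebra satisfies 1 != 0.  Algebras that may vanish (finite
     products, End of a possibly zero module) are given as concrete types
     carrying both a ring and an F-module structure.
   - F-algebra homomorphisms are [{lrmorphism A -> B}]: F-linear,
     multiplicative, and sending 1 to 1.
   - The opposite algebra of A is [A^c], and a right A-module is a left
     A^c-module.
   - [D : F] is [\dim {: D}].  For a right module V over a division algebra D,
     given as [V : vectType D^c], dim_D V is [dim V]. *)

HB.instance Definition _ (F : fieldType) (A : lmodType F) :=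
  GRing.Lmodule.copy A^c A.

HB.instance Definition _ (F : fieldType) (A : vectType F) :=
  Vector.copy A^c A.

Section Opposite.
Variables (F : fieldType) (A : algType F).

Fact opp_scalerAl (a : F) (u v : A^c) : a *: (u * v) = (a *: u : A^c) * v.
Proof. exact: (@scalerAr F A a v u). Qed.
HB.instance Definition _ :=
  GRing.Lmodule_isLalgebra.Build F A^c opp_scalerAl.

Fact opp_scalerAr (a : F) (u v : A^c) : a *: (u * v) = u * (a *: v : A^c).
Proof. exact: (@scalerAl F A a v u). Qed.
HB.instance Definition _ :=
  GRing.Lalgebra_isAlgebra.Build F A^c opp_scalerAr.

End Opposite.

HB.instance Definition _ (F : fieldType) (A : falgType F) :=
  GRing.Algebra.on A^c.

Section ProductZmod.
Variables (I : finType) (T : I -> zmodType).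
Local Notation prod := {dffun forall i, T i}.
Implicit Types f g h : prod.

Definition dffun_zero : prod := [ffun i : I => 0 : T i].
Definition dffun_opp f : prod := [ffun i : I => - f i].
Definition dffun_add f g : prod := [ffun i : I => f i + g i].

Fact dffun_addA : associative dffun_add.
Proof. by move=> f g h; apply/ffunP => i; rewrite !ffunE addrA. Qed.
Fact dffun_addC : commutative dffun_add.
Proof. by move=> f g; apply/ffunP => i; rewrite !ffunE addrC. Qed.
Fact dffun_add0 : left_id dffun_zero dffun_add.
Proof. by move=> f; apply/ffunP => i; rewrite !ffunE add0r. Qed.
Fact dffun_addN : left_inverse dffun_zero dffun_opp dffun_add.
Proof. by move=> f; apply/ffunP => i; rewrite !ffunE addNr. Qed.

HB.instance Definition _ := GRing.isZmodule.Build prod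
  dffun_addA dffun_addC dffun_add0 dffun_addN.

End ProductZmod.

Section ProductRing.
Variables (I : finType) (T : I -> pzRingType).
Local Notation prod := {dffun forall i, T i}.
Implicit Types f g h : prod.

Definition dffun_one : prod := [ffun i : I => 1 : T i].
Definition dffun_mul f g : prod := [ffun i : I => f i * g i].

Fact dffun_mulA : associative dffun_mul.
Proof. by move=> f g h; apply/ffunP => i; rewrite !ffunE mulrA. Qed.
Fact dffun_mul1 : left_id dffun_one dffun_mul.
Proof. by move=> f; apply/ffunP => i; rewrite !ffunE mul1r. Qed.
Fact dffun_mulr1 : right_id dffun_one dffun_mul.
Proof. by move=> f; apply/ffunP => i; rewrite !ffunE mulr1. Qed.
Fact dffun_mulDl : left_distributive dffun_mul +%R.
Proof. by move=> f g h; apply/ffunP => i; rewrite !ffunE mulrDl. Qed.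
Fact dffun_mulDr : right_distributive dffun_mul +%R.
Proof. by move=> f g h; apply/ffunP => i; rewrite !ffunE mulrDr. Qed.

HB.instance Definition _ := GRing.Zmodule_isPzRing.Build prod
  dffun_mulA dffun_mul1 dffun_mulr1 dffun_mulDl dffun_mulDr.

End ProductRing.

Section ProductLmod.
Variables (F : fieldType) (I : finType) (T : I -> lmodType F).
Local Notation prod := {dffun forall i, T i}.
Implicit Types f g h : prod.

Definition dffun_scale (a : F) f : prod := [ffun i : I => a *: f i].

Fact dffun_scaleA a b f :
  dffun_scale a (dffun_scale b f) = dffun_scale (a * b) f.
Proof. by apply/ffunP => i; rewrite !ffunE scalerA. Qed.
Fact dffun_scale1 : left_id 1 dffun_scale.
Proof. by move=> f; apply/ffunP => i; rewrite !ffunE scale1r. Qed.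
Fact dffun_scaleDr : right_distributive dffun_scale +%R.
Proof. by move=> a f g; apply/ffunP => i; rewrite !ffunE scalerDr. Qed.
Fact dffun_scaleDl f : {morph dffun_scale^~ f : a b / a + b}.
Proof. by move=> a b; apply/ffunP => i; rewrite !ffunE scalerDl. Qed.

HB.instance Definition _ := GRing.Zmodule_isLmodule.Build F prod
  dffun_scaleA dffun_scale1 dffun_scaleDr dffun_scaleDl.

End ProductLmod.

(* An alias of 'M[D]_m, on which F (and not D) acts, entrywise. *)

Definition mat_alg (F : fieldType) (m : nat) (D : falgType F) : Type := 'M[D]_m.

Section MatrixAlgebra.
Variables (F : fieldType) (m : nat) (D : falgType F).
Local Notation M := (mat_alg m D).
Implicit Types x y : M.

HB.instance Definition _ := GRing.PzRing.copy M 'M[D]_m.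

Definition mat_scale (a : F) (x : M) : M := map_mx ( *:%R a) x.

Fact mat_scaleA a b x : mat_scale a (mat_scale b x) = mat_scale (a * b) x.
Proof. by apply/matrixP => i j; rewrite !mxE scalerA. Qed.
Fact mat_scale1 : left_id 1 mat_scale.
Proof. by move=> x; apply/matrixP => i j; rewrite !mxE scale1r. Qed.
Fact mat_scaleDr : right_distributive mat_scale +%R.
Proof. by move=> a x y; apply/matrixP => i j; rewrite !mxE scalerDr. Qed.
Fact mat_scaleDl x : {morph mat_scale^~ x : a b / a + b}.
Proof. by move=> a b; apply/matrixP => i j; rewrite !mxE scalerDl. Qed.

HB.instance Definition _ := GRing.Zmodule_isLmodule.Build F M
  mat_scaleA mat_scale1 mat_scaleDr mat_scaleDl.

Lemma mat_scalerAl (a : F) x y : a *: (x * y) = (a *: x) * y.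
Proof.
apply/matrixP => i j; rewrite !mxE scaler_sumr.
by apply: eq_bigr => k _; rewrite !mxE scalerAl.
Qed.

Lemma mat_scalerAr (a : F) x y : a *: (x * y) = x * (a *: y).
Proof.
apply/matrixP => i j; rewrite !mxE scaler_sumr.
by apply: eq_bigr => k _; rewrite !mxE scalerAr.
Qed.

End MatrixAlgebra.

(* End_D(V) for a right D-module V, i.e. a left D^c-module.  The product is
   composition, and a : F sends f to v |-> f v * (a 1_D), which is D-linear
   because a 1_D is central. *)

Definition end_alg (F : fieldType) (D : falgType F) (V : vectType D^c) : Type :=
  'End(V).

Section EndAlgebra.
Variables (F : fieldType) (D : falgType F) (V : vectType D^c).
Local Notation E := (end_alg V).
Implicit Types f g h : E.

HB.instance Definition _ := GRing.Zmodule.copy E 'End(V).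

Definition end_one : E := \1%VF.
Definition end_mul f g : E := (f \o g)%VF.

Fact end_mulA : associative end_mul.
Proof. by move=> f g h; apply: comp_lfunA. Qed.
Fact end_mul1 : left_id end_one end_mul.
Proof. by move=> f; apply: comp_lfun1l. Qed.
Fact end_mulr1 : right_id end_one end_mul.
Proof. by move=> f; apply: comp_lfun1r. Qed.
Fact end_mulDl : left_distributive end_mul +%R.
Proof. by move=> f g h; apply: comp_lfunDl. Qed.
Fact end_mulDr : right_distributive end_mul +%R.
Proof. by move=> f g h; apply: comp_lfunDr. Qed.

HB.instance Definition _ := GRing.Zmodule_isPzRing.Build E
  end_mulA end_mul1 end_mulr1 end_mulDl end_mulDr.

Definition scalar_act (a : F) (v : V) : V := (a%:A : D^c) *: v.

Fact scalar_act_linear a : linear (scalar_act a).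
Proof.
move=> d u v; rewrite /scalar_act scalerDr !scalerA; congr (_ *: _ + _).
by rewrite -[LHS]/((d : D) * a%:A) -[RHS]/(a%:A * (d : D)) mulr_algr mulr_algl.
Qed.
HB.instance Definition _ a :=
  GRing.isLinear.Build D^c V V *:%R (scalar_act a) (scalar_act_linear a).

Definition end_scale (a : F) f : E := (linfun (scalar_act a) \o f)%VF.

Lemma end_scaleE a f v : (end_scale a f : 'End(V)) v = (a%:A : D^c) *: (f : 'End(V)) v.
Proof. by rewrite comp_lfunE lfunE. Qed.

Fact end_scaleA a b f : end_scale a (end_scale b f) = end_scale (a * b) f.
Proof.
apply/lfunP => v; rewrite !end_scaleE scalerA; congr (_ *: _).
by rewrite -[LHS]/((b%:A : D) * a%:A) mulr_algr scalerA.
Qed.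
Fact end_scale1 : left_id 1 end_scale.
Proof. by move=> f; apply/lfunP => v; rewrite end_scaleE scale1r scale1r. Qed.
Fact end_scaleDr : right_distributive end_scale +%R.
Proof. by move=> a f g; apply: comp_lfunDr. Qed.
Fact end_scaleDl f : {morph end_scale^~ f : a b / a + b}.
Proof.
move=> a b; apply/lfunP => v; rewrite add_lfunE !end_scaleE -scalerDl.
by rewrite -[in RHS](scalerDl (1 : D)).
Qed.

HB.instance Definition _ := GRing.Zmodule_isLmodule.Build F E
  end_scaleA end_scale1 end_scaleDr end_scaleDl.

Lemma end_scalerAl (a : F) f g : a *: (f * g) = (a *: f) * g.
Proof. exact: comp_lfunA. Qed.

Lemma end_scalerAr (a : F) f g : a *: (f * g) = f * (a *: g).
Proof.
change ((linfun (scalar_act a) \o (f \o g))%VF =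
        (f \o (linfun (scalar_act a) \o g))%VF).
by apply/lfunP => v; rewrite !comp_lfunE !lfunE /= /scalar_act linearZ.
Qed.

End EndAlgebra.

(* A (x)_F B, as the space of matrices indexed by bases (e_i) of A and (f_j)
   of B: the matrix M stands for \sum_(i, j) M i j e_i (x) f_j.  The product is
   the bilinear extension of (a (x) b) (c (x) d) = (a c) (x) (b d); see
   [tens_mul] for this formula, and [tens_univ] for the universal property. *)
Definition tensor_alg (F : fieldType) (A B : falgType F) : Type :=
  'M[F]_(dim A, dim B).

Section TensorProduct.
Import VectorInternalTheory.
Variables (F : fieldType) (A B : falgType F).
Local Notation T := (tensor_alg A B).
Implicit Types (a c : A) (b d : B) (M N P : T).

HB.instance Definition _ := Vector.copy T 'M[F]_(dim A, dim B).

Definition tens a b : T := (v2r a)^T *m v2r b.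

Lemma tensE a b i j : (tens a b : 'M_(_, _)) i j = v2r a 0 i * v2r b 0 j.
Proof. by rewrite mxE big_ord1 mxE. Qed.

Lemma tensDl b : {morph tens^~ b : a c / a + c}.
Proof. by move=> a c; rewrite /tens !linearD /= mulmxDl. Qed.
Lemma tensDr a : {morph tens a : b d / b + d}.
Proof. by move=> b d; rewrite /tens !linearD. Qed.
Lemma tensZl k a b : tens (k *: a) b = k *: tens a b.
Proof. by rewrite /tens !linearZ /= scalemxAl. Qed.
Lemma tensZr k a b : tens a (k *: b) = k *: tens a b.
Proof. by rewrite /tens !linearZ /= scalemxAr. Qed.
Lemma tens0l b : tens 0 b = 0.
Proof. by rewrite -(scale0r 0) tensZl scale0r. Qed.
Lemma tens0r a : tens a 0 = 0.
Proof. by rewrite -(scale0r 0) tensZr scale0r. Qed.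
Lemma tens_suml (I : finType) (f : I -> A) b :
  tens (\sum_i f i) b = \sum_i tens (f i) b.
Proof. exact: (big_morph (tens^~ b) (tensDl b) (tens0l b)). Qed.
Lemma tens_sumr (I : finType) a (f : I -> B) :
  tens a (\sum_i f i) = \sum_i tens a (f i).
Proof. exact: (big_morph (tens a) (tensDr a) (tens0r a)). Qed.

Definition basl (i : 'I_(dim A)) : A := r2v (delta_mx 0 i).
Definition basr (j : 'I_(dim B)) : B := r2v (delta_mx 0 j).

Lemma basl_sum a : a = \sum_i v2r a 0 i *: basl i.
Proof.
apply: v2r_inj; rewrite linear_sum {1}[v2r a]row_sum_delta.
by apply: eq_bigr => i _; rewrite linearZ /= r2vK.
Qed.
Lemma basr_sum b : b = \sum_j v2r b 0 j *: basr j.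
Proof.
apply: v2r_inj; rewrite linear_sum {1}[v2r b]row_sum_delta.
by apply: eq_bigr => j _; rewrite linearZ /= r2vK.
Qed.

Lemma tens_bas i j : tens (basl i) (basr j) = delta_mx i j.
Proof. by rewrite /tens !r2vK trmx_delta mul_delta_mx. Qed.

Lemma tens_sum M :
  M = \sum_i \sum_j (M : 'M_(_, _)) i j *: tens (basl i) (basr j).
Proof.
rewrite {1}[M]matrix_sum_delta; apply: eq_bigr => i _.
by apply: eq_bigr => j _; rewrite tens_bas.
Qed.

Lemma tens_ind (Q : T -> Prop) :
  Q 0 -> (forall M N, Q M -> Q N -> Q (M + N)) -> (forall a b, Q (tens a b)) ->
  forall M, Q M.
Proof.
move=> Q0 QD Qt M; rewrite (tens_sum M).
by elim/big_ind: _ => // i _; elim/big_ind: _ => // j _; rewrite -tensZl.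
Qed.

Definition tensor_one : T := tens 1 1.

Definition tensor_mul M N : T :=
  \sum_i \sum_j \sum_k \sum_l
    ((M : 'M_(_, _)) i j * (N : 'M_(_, _)) k l)
      *: tens (basl i * basl k) (basr j * basr l).

Fact tensor_mulDl : left_distributive tensor_mul +%R.
Proof.
move=> M N P; rewrite /tensor_mul -big_split; apply: eq_bigr => i _.
rewrite -big_split; apply: eq_bigr => j _.
rewrite -big_split; apply: eq_bigr => k _.
rewrite -big_split; apply: eq_bigr => l _.
by rewrite mxE mulrDl scalerDl.
Qed.
Fact tensor_mulDr : right_distributive tensor_mul +%R.
Proof.
move=> M N P; rewrite /tensor_mul -big_split; apply: eq_bigr => i _.
rewrite -big_split; apply: eq_bigr => j _.
rewrite -big_split; apply: eq_bigr => k _.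
rewrite -big_split; apply: eq_bigr => l _.
by rewrite mxE mulrDr scalerDl.
Qed.
Fact tensor_mul0 M : tensor_mul 0 M = 0.
Proof. by apply: (addIr (tensor_mul 0 M)); rewrite -tensor_mulDl !add0r. Qed.
Fact tensor_mulr0 M : tensor_mul M 0 = 0.
Proof. by apply: (addIr (tensor_mul M 0)); rewrite -tensor_mulDr !add0r. Qed.

Fact tensor_mul_tens a b c d :
  tensor_mul (tens a b) (tens c d) = tens (a * c) (b * d).
Proof.
rewrite [in RHS](basl_sum a) [in RHS](basr_sum b).
rewrite mulr_suml tens_suml; apply: eq_bigr => i _.
rewrite mulr_suml tens_sumr; apply: eq_bigr => j _.
rewrite [in RHS](basl_sum c) [in RHS](basr_sum d).
rewrite mulr_sumr tens_suml; apply: eq_bigr => k _.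
rewrite mulr_sumr tens_sumr; apply: eq_bigr => l _.
rewrite !tensE -!scalerAl -!scalerAr !tensZl !tensZr !scalerA.
by congr (_ *: _); rewrite -!mulrA; congr (_ * _); rewrite mulrCA.
Qed.

Fact tensor_mulA : associative tensor_mul.
Proof.
move=> M N P; elim/tens_ind: M => [|M M' IH IH'|a b].
- by rewrite !tensor_mul0.
- by rewrite !tensor_mulDl IH IH'.
elim/tens_ind: N => [|N N' IH IH'|c d].
- by rewrite tensor_mulr0 !tensor_mul0 tensor_mulr0.
- by rewrite tensor_mulDr !tensor_mulDl tensor_mulDr IH IH'.
elim/tens_ind: P => [|P P' IH IH'|e f].
- by rewrite !tensor_mulr0.
- by rewrite !tensor_mulDr IH IH'.
by rewrite !tensor_mul_tens !mulrA.
Qed.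
Fact tensor_mul1 : left_id tensor_one tensor_mul.
Proof.
elim/tens_ind => [|M N IH IH'|a b]; first exact: tensor_mulr0.
- by rewrite tensor_mulDr IH IH'.
by rewrite tensor_mul_tens !mul1r.
Qed.
Fact tensor_mulr1 : right_id tensor_one tensor_mul.
Proof.
elim/tens_ind => [|M N IH IH'|a b]; first exact: tensor_mul0.
- by rewrite tensor_mulDl IH IH'.
by rewrite tensor_mul_tens !mulr1.
Qed.
Fact tensor_one_neq0 : tensor_one != 0.
Proof.
have v2r1 (C : falgType F) : exists i, v2r (1 : C) 0 i != 0.
  apply/existsP; apply: contraT => /existsPn v0; case/eqP: (oner_neq0 C).
  by apply: v2r_inj; rewrite linear0; apply/rowP => i; rewrite mxE (eqP (negPn (v0 i))).
have [[i Ai] [j Bj]] := (v2r1 A, v2r1 B).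
apply/eqP => /matrixP/(_ i j)/eqP.
by rewrite [X in X == _]tensE mxE mulf_eq0 (negPf Ai) (negPf Bj).
Qed.

HB.instance Definition _ := GRing.Zmodule_isNzRing.Build T
  tensor_mulA tensor_mul1 tensor_mulr1 tensor_mulDl tensor_mulDr
  tensor_one_neq0.

Lemma tens_mul a b c d : tens a b * tens c d = tens (a * c) (b * d).
Proof. exact: tensor_mul_tens. Qed.

Lemma tens_one : tens 1 1 = 1.
Proof. by []. Qed.

Fact tensor_scalerAl (k : F) M N : k *: (M * N) = (k *: M : T) * N.
Proof.
elim/tens_ind: M => [|M M' IH IH'|a b].
- by rewrite scaler0 !mul0r scaler0.
- by rewrite mulrDl !scalerDr mulrDl IH IH'.
elim/tens_ind: N => [|N N' IH IH'|c d].
- by rewrite !mulr0 scaler0.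
- by rewrite !mulrDr scalerDr IH IH'.
by rewrite -tensZl !tens_mul -tensZl scalerAl.
Qed.
HB.instance Definition _ := GRing.Lmodule_isLalgebra.Build F T tensor_scalerAl.

Fact tensor_scalerAr (k : F) M N : k *: (M * N) = M * (k *: N : T).
Proof.
elim/tens_ind: M => [|M M' IH IH'|a b].
- by rewrite !mul0r scaler0.
- by rewrite !mulrDl scalerDr IH IH'.
elim/tens_ind: N => [|N N' IH IH'|c d].
- by rewrite scaler0 !mulr0 scaler0.
- by rewrite mulrDr !scalerDr mulrDr IH IH'.
by rewrite -tensZr !tens_mul -tensZr scalerAr.
Qed.
HB.instance Definition _ :=
  GRing.Lalgebra_isAlgebra.Build F T tensor_scalerAr.
HB.instance Definition _ := Algebra_isFalgebra.Build F T.

Lemma tens_univ (U : lmodType F) (h : A -> B -> U) :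
    (forall b, linear (h^~ b)) -> (forall a, linear (h a)) ->
  exists2 g : {linear T -> U}, (forall a b, g (tens a b) = h a b)
    & forall g' : {linear T -> U},
        (forall a b, g' (tens a b) = h a b) -> g' =1 g.
Proof.
move=> hl hr.
pose gf M := \sum_i \sum_j (M : 'M_(_, _)) i j *: h (basl i) (basr j).
have g_lin : linear gf.
  move=> k M N; rewrite /gf scaler_sumr -big_split; apply: eq_bigr => i _.
  rewrite scaler_sumr -big_split; apply: eq_bigr => j _.
  by rewrite !mxE scalerDl scalerA.
pose gM := GRing.isLinear.Build F T U *:%R gf g_lin.
pose g : {linear T -> U} := HB.pack gf gM.
have hlM b := GRing.isLinear.Build F A U *:%R (h^~ b) (hl b).
have hrM a := GRing.isLinear.Build F B U *:%R (h a) (hr a).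
pose hL b : {linear A -> U} := HB.pack (h^~ b) (hlM b).
pose hR a : {linear B -> U} := HB.pack (h a) (hrM a).
have gE a b : g (tens a b) = h a b.
  rewrite -[RHS]/(hL b a) {2}(basl_sum a) linear_sum; apply: eq_bigr => i _.
  rewrite linearZ /= -[h _ _]/(hR (basl i) b) {2}(basr_sum b) linear_sum.
  rewrite scaler_sumr; apply: eq_bigr => j _.
  by rewrite linearZ scalerA [X in X *: _ = _]tensE.
exists g => // g' g'E M; elim/tens_ind: M => [|M N IH IH'|a b].
- by rewrite !linear0.
- by rewrite !linearD IH IH'.
by rewrite gE g'E.
Qed.

End TensorProduct.

(* Ideals of a unital F-algebra are F-subspaces, since F acts through its
   centre; hence the use of {vspace C}. *)
Section Ideals.
Variables (F : fieldType) (C : falgType F).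
Implicit Types I J M N : {vspace C}.

Definition left_ideal I : Prop := forall a x, x \in I -> a * x \in I.

Definition twosided_ideal I : Prop :=
  left_ideal I /\ forall a x, x \in I -> x * a \in I.

Definition maximal_left_ideal M : Prop :=
  [/\ left_ideal M, M != fullv &
      forall N, left_ideal N -> (M <= N)%VS -> N = M \/ N = fullv].

(* C is nonzero, being a falgType. *)
Definition simple_algebra : Prop :=
  forall I, twosided_ideal I -> I = 0%VS \/ I = fullv.

Definition semisimple_algebra : Prop :=
  forall I, left_ideal I ->
    exists J, [/\ left_ideal J, (I + J)%VS = fullv & (I :&: J)%VS = 0%VS].

Definition jacobson_rad : {pred C} :=
  fun x => `[< forall M, maximal_left_ideal M -> x \in M >].

Lemma jacobson_radP x :
  reflect (forall M, maximal_left_ideal M -> x \in M) (x \in jacobson_rad).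
Proof. exact: asboolP. Qed.

Fact jacobson_rad_zmod : zmod_closed jacobson_rad.
Proof.
split=> [|x y /jacobson_radP xJ /jacobson_radP yJ]; apply/jacobson_radP => M maxM.
  exact: mem0v.
by rewrite rpredB ?xJ ?yJ.
Qed.
HB.instance Definition _ := GRing.isZmodClosed.Build C jacobson_rad
  jacobson_rad_zmod.

Lemma jacobson_rad_left a x : x \in jacobson_rad -> a * x \in jacobson_rad.
Proof.
move=> /jacobson_radP xJ; apply/jacobson_radP => M maxM.
by case: (maxM) => lM _ _; apply: lM; apply: xJ.
Qed.

Lemma fullv_mem1 I : left_ideal I -> 1 \in I -> I = fullv.
Proof.
move=> lI I1; apply/eqP; rewrite eqEsubv subvf; apply/subvP => x _.
by rewrite -[x]mulr1; apply: lI.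
Qed.

Lemma jacobson_rad_right x a : x \in jacobson_rad -> x * a \in jacobson_rad.
Proof.
move=> /jacobson_radP xJ; apply/jacobson_radP => M maxM.
have [lM Mproper maxM'] := maxM.
pose K := (amulr a @^-1: M)%VS.
have memK y : (y \in K) = (y * a \in M) by rewrite -memv_preim lfunE.
have lK : left_ideal K by move=> b y; rewrite !memK -mulrA; apply: lM.
rewrite -memK; have [-> | Kproper] := eqVneq K fullv; first exact: memvf.
apply: xJ; split=> // N lN KN.
have lNaM : left_ideal (amulr a @: N + M)%VS.
  move=> b _ /memv_addP[_ /memv_imgP[n nN ->] [m mM ->]].
  rewrite lfunE /= mulrDr mulrA; apply: memv_add; last exact: lM.
  by apply/memv_imgP; exists (b * n); [exact: lN | rewrite lfunE].
case: (maxM' _ lNaM (addvSr _ _)) => NaM; [left | right].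
  apply/eqP; rewrite eqEsubv KN andbT; apply/subvP => n nN; rewrite memK -NaM.
  rewrite -[_ * _]addr0; apply: memv_add (mem0v _).
  by apply/memv_imgP; exists n => //; rewrite lfunE.
apply: fullv_mem1 => //; have: a \in (amulr a @: N + M)%VS by rewrite NaM memvf.
move=> /memv_addP[_ /memv_imgP[n nN ->] [m mM]]; rewrite lfunE /= => Da.
rewrite -[1](subrK n) rpredD //; apply: (subvP KN).
by rewrite memK mulrBl mul1r {1}Da addrAC subrr add0r.
Qed.

Lemma maximal_left_ideal_exists : exists M, maximal_left_ideal M.
Proof.
pose P (n : nat) := `[< exists I, [/\ left_ideal I, I != fullv & \dim I = n] >].
have P0 : exists n, P n.
  exists 0%N; apply/asboolP; exists 0%VS; split; last exact: dimv0.
    by move=> a x; rewrite !memv0 => /eqP ->; rewrite mulr0.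
  apply/eqP => /vspaceP/(_ 1); by rewrite memvf memv0 oner_eq0.
have Pb n : P n -> (n <= \dim {:C})%N.
  by move=> /asboolP[I [_ _ <-]]; apply/dimvS/subvf.
have [n /asboolP[M [lM Mp dM]] maxn] := ex_maxnP P0 Pb.
exists M; split=> // N lN MN; have [-> | Np] := eqVneq N fullv; first by right.
left; apply/esym/eqP; rewrite eqEdim MN dM.
by apply: maxn; apply/asboolP; exists N.
Qed.

Lemma jacobson_rad_proper : 1 \notin jacobson_rad.
Proof.
have [M maxM] := maximal_left_ideal_exists.
apply/negP => /jacobson_radP/(_ M maxM) M1; have [lM /eqP + _] := maxM.
by apply; apply: fullv_mem1.
Qed.

End Ideals.

(* C^ss = C / rad C *)
Definition ss_quotient (F : fieldType) (C : falgType F) : Type :=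
  Quotient.quot (@jacobson_rad F C).

Section SemisimpleQuotient.
Local Open Scope quotient_scope.
Variables (F : fieldType) (C : falgType F).
Local Notation Q := (ss_quotient C).

HB.instance Definition _ := GRing.Zmodule.copy Q (Quotient.quot (@jacobson_rad F C)).

Definition ss_pi (x : C) : Q := \pi_(Quotient.quot (@jacobson_rad F C)) x.
Definition ss_repr (u : Q) : C := repr (u : Quotient.quot (@jacobson_rad F C)).

Lemma ss_reprK u : ss_pi (ss_repr u) = u.
Proof. exact: reprK. Qed.

Lemma ss_pi_eq x y : (ss_pi x == ss_pi y) = (x - y \in @jacobson_rad F C).
Proof. by rewrite Quotient.idealrBE. Qed.

Lemma ss_repr_pi x : ss_repr (ss_pi x) - x \in @jacobson_rad F C.
Proof. by rewrite -ss_pi_eq ss_reprK. Qed.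

Lemma ss_piD : {morph ss_pi : x y / x + y}.
Proof. by move=> x y; rewrite /ss_pi raddfD. Qed.

Definition ss_one : Q := ss_pi 1.
Definition ss_mul (u v : Q) : Q := ss_pi (ss_repr u * ss_repr v).
Definition ss_scale (a : F) (u : Q) : Q := ss_pi (a *: ss_repr u).

Lemma ss_pi_mul x y : ss_mul (ss_pi x) (ss_pi y) = ss_pi (x * y).
Proof.
apply/eqP; rewrite ss_pi_eq.
set x' := ss_repr _; set y' := ss_repr _.
have -> : x' * y' - x * y = (x' - x) * y' + x * (y' - y).
  by rewrite mulrBl mulrBr addrA subrK.
apply: rpredD; [apply: jacobson_rad_right | apply: jacobson_rad_left];
  exact: ss_repr_pi.
Qed.

Lemma ss_pi_scale a x : ss_scale a (ss_pi x) = ss_pi (a *: x).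
Proof.
apply/eqP; rewrite ss_pi_eq -scalerBr -mulr_algl.
by rewrite jacobson_rad_left // ss_repr_pi.
Qed.

Lemma ss_ind (P : Q -> Prop) : (forall x, P (ss_pi x)) -> forall u, P u.
Proof. by move=> PP u; rewrite -(ss_reprK u). Qed.

Fact ss_mulA : associative ss_mul.
Proof.
elim/ss_ind=> x; elim/ss_ind=> y; elim/ss_ind=> z.
by rewrite !ss_pi_mul mulrA.
Qed.
Fact ss_mul1 : left_id ss_one ss_mul.
Proof. by elim/ss_ind=> x; rewrite ss_pi_mul mul1r. Qed.
Fact ss_mulr1 : right_id ss_one ss_mul.
Proof. by elim/ss_ind=> x; rewrite ss_pi_mul mulr1. Qed.
Fact ss_mulDl : left_distributive ss_mul +%R.
Proof.
elim/ss_ind=> x; elim/ss_ind=> y; elim/ss_ind=> z.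
by rewrite -ss_piD !ss_pi_mul -ss_piD mulrDl.
Qed.
Fact ss_mulDr : right_distributive ss_mul +%R.
Proof.
elim/ss_ind=> x; elim/ss_ind=> y; elim/ss_ind=> z.
by rewrite -ss_piD !ss_pi_mul -ss_piD mulrDr.
Qed.
Fact ss_pi0 : ss_pi 0 = 0.
Proof. by apply: (addIr (ss_pi 0)); rewrite -ss_piD !add0r. Qed.
Fact ss_one_neq0 : ss_one != 0.
Proof. by rewrite -ss_pi0 ss_pi_eq subr0 jacobson_rad_proper. Qed.

HB.instance Definition _ := GRing.Zmodule_isNzRing.Build Q
  ss_mulA ss_mul1 ss_mulr1 ss_mulDl ss_mulDr ss_one_neq0.

Fact ss_scaleA a b u : ss_scale a (ss_scale b u) = ss_scale (a * b) u.
Proof. by elim/ss_ind: u => x; rewrite !ss_pi_scale scalerA. Qed.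
Fact ss_scale1 : left_id 1 ss_scale.
Proof. by elim/ss_ind=> x; rewrite ss_pi_scale scale1r. Qed.
Fact ss_scaleDr : right_distributive ss_scale +%R.
Proof.
move=> a; elim/ss_ind=> x; elim/ss_ind=> y.
by rewrite -ss_piD !ss_pi_scale -ss_piD scalerDr.
Qed.
Fact ss_scaleDl u : {morph ss_scale^~ u : a b / a + b}.
Proof.
by elim/ss_ind: u => x a b; rewrite !ss_pi_scale -ss_piD scalerDl.
Qed.
HB.instance Definition _ := GRing.Zmodule_isLmodule.Build F Q
  ss_scaleA ss_scale1 ss_scaleDr ss_scaleDl.

Fact ss_scalerAl (a : F) (u v : Q) : a *: (u * v) = (a *: u : Q) * v.
Proof.
elim/ss_ind: u => x; elim/ss_ind: v => y.
change (ss_scale a (ss_mul (ss_pi x) (ss_pi y)) =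
        ss_mul (ss_scale a (ss_pi x)) (ss_pi y)).
by rewrite ss_pi_mul !ss_pi_scale ss_pi_mul scalerAl.
Qed.
HB.instance Definition _ := GRing.Lmodule_isLalgebra.Build F Q ss_scalerAl.

Fact ss_scalerAr (a : F) (u v : Q) : a *: (u * v) = u * (a *: v : Q).
Proof.
elim/ss_ind: u => x; elim/ss_ind: v => y.
change (ss_scale a (ss_mul (ss_pi x) (ss_pi y)) =
        ss_mul (ss_pi x) (ss_scale a (ss_pi y))).
by rewrite ss_pi_mul !ss_pi_scale ss_pi_mul scalerAr.
Qed.
HB.instance Definition _ := GRing.Lalgebra_isAlgebra.Build F Q ss_scalerAr.

End SemisimpleQuotient.

Definition division_algebra (F : fieldType) (D : falgType F) : Prop :=
  GRing.field_axiom D.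

Definition wedderburn_decomposition (F : fieldType) (Q : algType F) (t : nat)
    (m : 'I_t -> nat) (D : 'I_t -> falgType F) : Prop :=
  [/\ forall k, (0 < m k)%N, forall k, division_algebra (D k) &
      exists f : {lrmorphism Q -> {dffun forall k : 'I_t, mat_alg (m k) (D k)}},
        bijective f].

(* Main.v *)
Require Import Defs.
From HB Require Import structures.
From mathcomp Require Import all_boot all_order all_algebra all_field.
From mathcomp Require Import boolp.

(* A homomorphism A -> End_Delta(V) is the same as a right module over
   C = Delta (x) A^o whose restriction to Delta is V, and right modules over a
   division algebra are classified by their dimension. All composition factors
   of a C-module are modules over C^ss = \prod_k Mat_(m_k)(D_k), hence spaces of
   rows D_k^(m_k); so the F-dimensions of C-modules are exactly the sums of
   n_k m_k [D_k : F]. Comparing with [Delta : F] dim_Delta V gives part (1), with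
   x_k = n_k (m_k [D_k : F] / [Delta : F]).
   For part (2), the central idempotents of A split each V_j into modules over
   Delta_j (x) A_i^o, and A -> B is injective iff each simple factor A_i acts
   nontrivially on some V_j. *)

Set Implicit Arguments.
Unset Strict Implicit.
Unset Printing Implicit Defensive.

Import GRing.Theory.
Local Open Scope ring_scope.

Lemma dim_falg_gt0 (F : fieldType) (D : falgType F) : (0 < \dim {:D})%N.
Proof.
by rewrite lt0n dimv_eq0; apply/eqP => /vspaceP/(_ 1); rewrite memvf memv0 oner_eq0.
Qed.

(** * Invertibility of 1 - x for x in the Jacobson radical *)

Section Radical.
Variables (F : fieldType) (C : falgType F).
Implicit Types (I M N : {vspace C}) (x y : C).

(** Among the proper left ideals containing [I], one of largest dimension is maximal. *)
Lemma left_ideal_sub_maximal I :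
  left_ideal I -> I != fullv -> exists2 M, maximal_left_ideal M & (I <= M)%VS.
Proof.
move=> lI pI.
pose P (n : nat) :=
  `[< exists N, [/\ left_ideal N, N != fullv, (I <= N)%VS & \dim N = n] >].
have P0 : exists n, P n by exists (\dim I); apply/asboolP; exists I.
have Pb n : P n -> (n <= \dim {:C})%N.
  by move=> /asboolP[N [_ _ _ <-]]; apply/dimvS/subvf.
have [n /asboolP[M [lM Mp IM dM]] maxn] := ex_maxnP P0 Pb.
exists M => //; split=> // N lN MN.
have [-> | Np] := eqVneq N fullv; first by right.
left; apply/esym/eqP; rewrite eqEdim MN dM.
apply: maxn; apply/asboolP; exists N; split=> //; exact: subv_trans MN.
Qed.

(** Otherwise the left ideal C(1 - x) is proper, hence lies in a maximal left ideal, which also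
    contains x and so 1. *)
Lemma jacobson_rad_left_inverse x :
  x \in @jacobson_rad F C -> exists y, y * (1 - x) = 1.
Proof.
move=> xJ; pose I := limg (amulr (1 - x)).
have lI : left_ideal I.
  move=> a _ /memv_imgP[b _ ->]; rewrite lfunE /= mulrA.
  by apply/memv_imgP; exists (a * b); rewrite ?memvf ?lfunE.
have [IT | pI] := eqVneq I fullv.
  have /memv_imgP[y _ Dy] : 1 \in I by rewrite IT memvf.
  by exists y; rewrite {2}Dy lfunE.
have [M maxM IM] := left_ideal_sub_maximal lI pI.
have [lM /eqP Mp _] := maxM; case: Mp; apply: (fullv_mem1 lM).
rewrite -[1](subrK x) memvD //; last by move/jacobson_radP: xJ; apply.
apply: (subvP IM); apply/memv_imgP; exists 1; first exact: memvf.
by rewrite lfunE /= mul1r.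
Qed.

(** A left inverse y of 1 - x equals 1 + yx with yx in the radical, so y has a left inverse z as
    well; having z on its left and 1 - x on its right, y forces z = 1 - x. *)
Lemma jacobson_rad_right_inverse x :
  x \in @jacobson_rad F C -> exists y, (1 - x) * y = 1.
Proof.
move=> xJ; have [y y1] := jacobson_rad_left_inverse xJ.
have yxJ : - (y * x) \in @jacobson_rad F C by rewrite rpredN jacobson_rad_left.
have [z] := jacobson_rad_left_inverse yxJ.
have -> : 1 - - (y * x) = y by move: y1; rewrite mulrBr mulr1 opprK => <-; rewrite subrK.
move=> zy; exists y; suff -> : 1 - x = z by [].
by rewrite -[LHS]mul1r -{1}zy -mulrA y1 mulr1.
Qed.

End Radical.

(** * Inclusions of the factors into a finite product of rings *)

Section Components.
Variables (F : fieldType) (I : finType).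

Section Ring.
Variable T : I -> pzRingType.
Local Notation prod := {dffun forall i, T i}.

Definition single (i : I) (x : T i) : prod :=
  [ffun k => dfwith (fun k => 0 : T k) x k].

Lemma singleE i (x : T i) : single x i = x.
Proof. by rewrite ffunE dfwith_in. Qed.

Lemma singleN i (x : T i) k : i != k -> single x k = 0.
Proof. by move=> ik; rewrite ffunE dfwith_out. Qed.

Lemma single_mulr i (x : T i) (p : prod) : single x * p = single (x * p i).
Proof.
apply/ffunP => k; have [<- | ik] := eqVneq i k; first by rewrite ffunE !singleE.
by rewrite ffunE !singleN // mul0r.
Qed.

Lemma dffun_sumE (J : Type) (r : seq J) (P : pred J) (f : J -> prod) k :
  (\sum_(j <- r | P j) f j) k = \sum_(j <- r | P j) f j k.
Proof.
elim/big_rec2: _ => [|j y z _ <-]; by rewrite ffunE.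
Qed.

Lemma sum_single (p : prod) : p = \sum_i single (p i).
Proof.
apply/ffunP => k; rewrite dffun_sumE (bigD1 k) //= singleE big1 ?addr0 //.
by move=> i ik; rewrite singleN.
Qed.

End Ring.

End Components.

(** Chosen preimages need not depend linearly on [p], so they are used only on a basis of [U] and
    extended by linearity. *)
Lemma linear_lift (F : fieldType) (U : vectType F) (C P : lmodType F)
    (g : {linear C -> P}) (h : {linear U -> P}) :
    (forall p, exists x, g x = p) ->
  exists h' : {linear U -> C}, forall u, g (h' u) = h u.
Proof.
move=> /choice[lift liftP]; pose X := vbasis {:U}.
pose f u := \sum_i coord X i u *: lift (h X`_i).
have f_lin : linear f.
  move=> a u v; rewrite /f scaler_sumr -big_split; apply: eq_bigr => i _.
  by rewrite linearP /= scalerDl scalerA.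
pose fM := GRing.isLinear.Build F U C *:%R f f_lin.
pose f' : {linear U -> C} := HB.pack f fM.
exists f' => u; rewrite {2}(coord_vbasis (memvf u)) !linear_sum.
by apply: eq_bigr => i _; rewrite !linearZ /= liftP.
Qed.

(** * Row spaces D^m as right modules over Mat_m(D) *)

Section RowMatrices.
Variables (F : fieldType) (m : nat) (D : falgType F).

(** For fixed [i] these matrices form a right ideal of Mat_m(D) isomorphic to the row module; this
    embeds rows in the algebra itself. *)
Definition row_matrix (i : 'I_m) (r : {ffun 'I_m -> D}) : mat_alg m D :=
  \matrix_(a, b) (if a == i then r b else 0).

Definition act_row (r : {ffun 'I_m -> D}) (p : mat_alg m D) : {ffun 'I_m -> D} :=
  [ffun j => \sum_b r b * (p : 'M_m) b j].

Definition std_row (i : 'I_m) (d : D) : {ffun 'I_m -> D} :=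
  [ffun j => if j == i then d else 0].

Fact row_matrix_linear i : linear (row_matrix i).
Proof.
move=> a r r'; apply/matrixP => b c; rewrite !mxE !ffunE.
by case: ifP; rewrite ?scaler0 ?addr0.
Qed.

Lemma row_matrixM i r p : row_matrix i r * p = row_matrix i (act_row r p).
Proof.
apply/matrixP => a b; rewrite !mxE ffunE; case: ifP => ai.
  by apply: eq_bigr => c _; rewrite !mxE ai.
by rewrite big1 // => c _; rewrite !mxE ai mul0r.
Qed.

Lemma act_row_matrix r i b d :
  act_row r (row_matrix b (std_row i d)) = std_row i (r b * d).
Proof.
apply/ffunP => j; rewrite !ffunE (bigD1 b) //= big1 ?addr0.
  by rewrite !mxE eqxx ffunE; case: ifP => _; rewrite ?mulr0.
by move=> c cb; rewrite !mxE (negPf cb) mulr0.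
Qed.

Lemma sum_row_matrix : \sum_i row_matrix i (std_row i 1) = 1.
Proof.
apply/matrixP => a b; rewrite summxE (bigD1 a) //= big1 ?addr0.
  by rewrite !mxE eqxx ffunE eq_sym; case: ifP.
by move=> i ia; rewrite !mxE eq_sym (negPf ia).
Qed.

Lemma act_row1 r : act_row r 1 = r.
Proof.
apply/ffunP => j; rewrite ffunE (bigD1 j) //= big1 ?addr0 => [|i ij].
  by rewrite !mxE eqxx mulr1.
by rewrite !mxE (negPf ij) mulr0.
Qed.

Lemma act_rowM r p q : act_row r (p * q) = act_row (act_row r p) q.
Proof.
apply/ffunP => j; rewrite !ffunE.
under [RHS]eq_bigr => b _ do rewrite ffunE mulr_suml.
rewrite exchange_big; apply: eq_bigr => c _ /=; rewrite !mxE mulr_sumr.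
by apply: eq_bigr => b _; rewrite mulrA.
Qed.

Lemma dim_row : dim {ffun 'I_m -> D} = (m * \dim {:D})%N.
Proof. by rewrite dimvf [LHS]/dim /= card_ord. Qed.

End RowMatrices.

(** * Composition factors and dimensions of right [C]-modules *)

Section Modules.
Variables (F : fieldType) (C : falgType F) (W : vectType F).
Variable rho : {linear C -> 'End(W)}.
Hypothesis rhoM : forall x y w, rho (x * y) w = rho y (rho x w).
Implicit Types (M N : {vspace W}).

(** Submodules. The action is not assumed unital on [W]: unitality is required only on the
    submodules studied, so that images of idempotents can be treated. *)
Definition stable M := forall x w, w \in M -> rho x w \in M.

Lemma stable_maximal M : stable M -> M != 0%VS ->
  exists M', [/\ stable M', (M' <= M)%VS, M' != M &
    forall N, stable N -> (M' <= N)%VS -> (N <= M)%VS -> N != M -> N = M'].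
Proof.
move=> sM M0.
pose P (n : nat) :=
  `[< exists N, [/\ stable N, (N <= M)%VS, N != M & \dim N = n] >].
have P0 : exists n, P n.
  exists 0%N; apply/asboolP; exists 0%VS; split; last exact: dimv0.
  - by move=> x w; rewrite !memv0 => /eqP->; rewrite linear0.
  - exact: sub0v.
  - by rewrite eq_sym.
have Pb n : P n -> (n <= \dim M)%N.
  by move=> /asboolP[N [_ NM _ <-]]; apply: dimvS.
have [n /asboolP[M' [sM' M'M pM' dM']] maxn] := ex_maxnP P0 Pb.
exists M'; split=> // N sN M'N NM pN; apply/esym/eqP; rewrite eqEdim M'N dM'.
by apply: maxn; apply/asboolP; exists N.
Qed.

Section MaximalSubmodule.
Variables M M' : {vspace W}.
Hypotheses (sM : stable M) (unitM : forall w, w \in M -> rho 1 w = w).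
Hypotheses (sM' : stable M') (M'M : (M' <= M)%VS) (M'_neq : M' != M).
Hypothesis maxM' :
  forall N, stable N -> (M' <= N)%VS -> (N <= M)%VS -> N != M -> N = M'.

(* Nakayama: if [u x] generates M modulo M', then [u (1 - x c)] lies in M' for
   some c, and [1 - x c] is invertible. *)
Lemma rad_kills x u : x \in @jacobson_rad F C -> u \in M -> rho x u \in M'.
Proof.
move=> xJ uM; pose L c := rho c (rho x u).
have L_lin : linear L.
  by move=> a c d; rewrite /L linearP add_lfunE scale_lfunE.
pose LM := GRing.isLinear.Build F C W *:%R L L_lin.
pose L' : {linear C -> W} := HB.pack L LM.
pose N := (M' + limg (linfun L'))%VS.
have memL c : L c \in N.
  rewrite -[L c]add0r memv_add ?mem0v //; apply/memv_imgP; exists c.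
    exact: memvf.
  by rewrite lfunE.
have sN : stable N.
  move=> y _ /memv_addP[v vM' [_ /memv_imgP[c _ ->] ->]].
  rewrite lfunE /= /L linearD /= memvD //.
    by rewrite (subvP (addvSl _ _)) ?sM'.
  by rewrite -rhoM memL.
have NM : (N <= M)%VS.
  rewrite subv_add M'M; apply/subvP => _ /memv_imgP[c _ ->].
  by rewrite lfunE /= /L !sM.
have Lxu : rho x u = L 1 by rewrite /L unitM ?sM.
have [NE | pN] := eqVneq N M; last first.
  by rewrite Lxu -(maxM' sN (addvSl _ _) NM pN).
have: u \in N by rewrite NE.
case/memv_addP=> v vM' [_ /memv_imgP[c _ ->]]; rewrite lfunE /= /L => Du.
have [y y1] := jacobson_rad_right_inverse (jacobson_rad_right c xJ).
apply: (sM'); rewrite -(unitM uM) -y1 rhoM sM' // linearB /=.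
rewrite add_lfunE opp_lfunE unitM // rhoM.
by move/eqP: Du; rewrite -subr_eq => /eqP->.
Qed.

Variables (t : nat) (m : 'I_t -> nat) (D : 'I_t -> falgType F).
Hypothesis D_div : forall k, division_algebra (D k).
Variable g : {lrmorphism C -> {dffun forall k : 'I_t, mat_alg (m k) (D k)}}.
Hypotheses (g_surj : forall p, exists x, g x = p).
Hypothesis (g_ker : forall x, g x = 0 -> x \in @jacobson_rad F C).

(** The radical kills M/M', so the action on this quotient factors through [g]. *)
Lemma congr_mod x y u :
  g x = g y -> u \in M -> (rho x u \in M') = (rho y u \in M').
Proof.
move=> gxy uM; suff r : rho (x - y) u \in M'.
  by rewrite -[x](subrK y) linearD add_lfunE /= rpredDl.
by apply: rad_kills uM; apply: g_ker; rewrite linearB /= gxy subrr.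
Qed.

(** The simple module M/M' is a row module: for a suitable u in M and index i, sending a row r to u
    times the matrix with i-th row r induces an isomorphism from D_k^(m_k) onto M/M'. *)
Lemma simple_factor :
  exists k, \dim M = (\dim M' + m k * \dim {:D k})%N.
Proof.
(* These are the diagonal matrix units of all the factors. They sum to 1, so one of them must move
   some u of M outside M'. *)
pose e (k : 'I_t) (i : 'I_(m k)) : {dffun forall k : 'I_t, mat_alg (m k) (D k)} :=
  single (i := k) (row_matrix i (std_row i 1)).
have [lift liftP] := choice g_surj.
have [k [i [u uM uk]]] : exists k i, exists2 u, u \in M & rho (lift (e k i)) u \notin M'.
  have /subvPn[u uM uM'] : ~~ (M <= M')%VS.
    by apply: contra M'_neq => MM'; rewrite eqEsubv M'M.
  apply: contrapT => noki; case/negP: uM'; rewrite -(unitM uM).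
  rewrite (@congr_mod _ (\sum_k \sum_i lift (e k i))) //.
    rewrite linear_sum sum_lfunE memv_suml // => k _.
    rewrite linear_sum sum_lfunE memv_suml // => i _.
    by apply: contrapT => /negP ki; apply: noki; exists k, i, u.
  rewrite linear_sum rmorph1 [LHS]sum_single; apply: eq_bigr => k _.
  rewrite linear_sum; under [RHS]eq_bigr => i _ do rewrite /= liftP.
  apply/ffunP => k'; rewrite dffun_sumE; have [<- | kk'] := eqVneq k k'.
    by rewrite singleE ffunE -sum_row_matrix; apply: eq_bigr => i _; rewrite singleE.
  by rewrite singleN // big1 // => i _; rewrite singleN.
exists k; pose hr (r : {ffun 'I_(m k) -> D k}) :
  {dffun forall k : 'I_t, mat_alg (m k) (D k)} := single (row_matrix i r).
have hr_lin : linear hr.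
  move=> a r r'; apply/ffunP => k'; rewrite !ffunE.
  have [<- | kk'] := eqVneq k k'; first by rewrite !dfwith_in row_matrix_linear.
  by rewrite !dfwith_out // scaler0 addr0.
pose hrM := GRing.isLinear.Build F _ _ *:%R hr hr_lin.
pose hr' : {linear {ffun 'I_(m k) -> D k} -> {dffun forall k : 'I_t, mat_alg (m k) (D k)}}
  := HB.pack hr hrM.
(* A linear lift of rows to [C]; [L] below is then linear, and compatible with the action only
   modulo M'. *)
have [h hP] := linear_lift hr' g_surj.
pose L r := rho (h r) u.
have L_lin : linear L.
  by move=> a c d; rewrite /L !linearP add_lfunE scale_lfunE.
pose LM := GRing.isLinear.Build F _ W *:%R L L_lin.
pose L' : {linear {ffun 'I_(m k) -> D k} -> W} := HB.pack L LM.
have gL r c : g (h r * c) = g (h (act_row r (g c k))).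
  by rewrite rmorphM /= !hP /= /hr single_mulr row_matrixM.
have L_e : L (std_row i 1) \notin M' by rewrite (@congr_mod _ (lift (e k i))) // hP liftP.
(* If the entry r_b is nonzero, right multiplication by the matrix with entry r_b^-1 in position (b,
   i) turns r into the standard row, whose image is outside M'. *)
have L_inj r : L r \in M' -> r = 0.
  move=> LrM'; apply/ffunP => b; rewrite ffunE; apply/eqP.
  apply: contraNT L_e => rb; have [d rbd] : exists d, r b * d = 1.
    by exists (r b)^-1; rewrite divrr // D_div.
  pose c := lift (single (row_matrix b (std_row i d))).
  rewrite -(@congr_mod (h r * c)) //; first by rewrite rhoM sM'.
  by rewrite gL liftP singleE act_row_matrix rbd.
pose N := (M' + limg (linfun L'))%VS.
have memL r : L r \in N.
  rewrite -[L r]add0r memv_add ?mem0v //; apply/memv_imgP; exists r.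
    exact: memvf.
  by rewrite lfunE.
have sN : stable N.
  move=> c _ /memv_addP[v vM' [_ /memv_imgP[r _ ->] ->]].
  rewrite lfunE /= linearD /= memvD //.
    by rewrite (subvP (addvSl _ _)) ?sM'.
  (* The elements [h r * c] and [h (act_row r (g c k))] differ by an element of the radical, which
     maps u into M'. *)
  rewrite /L -rhoM -[_ * c](subrK (h (act_row r (g c k)))) linearD add_lfunE.
  rewrite memvD //; last exact: memL.
  apply: (subvP (addvSl _ _)); apply: rad_kills => //; apply: g_ker.
  by rewrite linearB /= gL subrr.
(* N is a submodule between M' and M and differs from M' because it contains the image of the
   standard row; maximality of M' leaves only M. *)
have NE : N = M.
  apply/eqP; apply: contraNT L_e => pN; have <- // := maxM' sN (addvSl _ _) _ pN.
  rewrite subv_add M'M; apply/subvP => _ /memv_imgP[c _ ->].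
  by rewrite lfunE /= /L !sM.
rewrite -NE dimv_disjoint_sum.
  rewrite limg_dim_eq; first by rewrite [\dim {: {ffun _ -> _}}]dimvf dim_row.
  apply/eqP; rewrite -subv0; apply/subvP => r; rewrite memv_cap memv_ker lfunE /=.
  by case/andP=> _ /eqP Lr; rewrite memv0; apply/eqP/L_inj; rewrite Lr mem0v.
apply/eqP; rewrite -subv0; apply/subvP => w; rewrite memv_cap memv0.
case/andP=> wM' /memv_imgP[r _ Dw]; move: wM'; rewrite Dw lfunE /= => /L_inj->.
by rewrite -[L 0]/(L' 0) linear0.
Qed.

End MaximalSubmodule.

(** Induction along a composition series: [n k] counts the composition factors isomorphic to the
    k-th row module, and each step removes one of them from the top. *)
Lemma dim_module (t : nat) (m : 'I_t -> nat) (D : 'I_t -> falgType F)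
    (g : {lrmorphism C -> {dffun forall k : 'I_t, mat_alg (m k) (D k)}})
    (M : {vspace W}) :
    (forall k, division_algebra (D k)) ->
    (forall p, exists x, g x = p) ->
    (forall x, g x = 0 -> x \in @jacobson_rad F C) ->
    stable M -> (forall w, w \in M -> rho 1 w = w) ->
  exists n : 'I_t -> nat, \dim M = (\sum_k n k * (m k * \dim {:D k}))%N.
Proof.
move=> D_div g_surj g_ker.
have [d] := ubnP (\dim M); elim: d M => // d IH M; rewrite ltnS => dM sM unitM.
have [-> | M0] := eqVneq M 0%VS.
  by exists (fun=> 0%N); rewrite dimv0 big1.
have [M' [sM' M'M pM' maxM']] := stable_maximal sM M0.
have [k dMM'] := simple_factor sM unitM sM' M'M pM' maxM' D_div g_surj g_ker.
have ltM' : (\dim M' < \dim M)%N by rewrite ltn_neqAle dimvS // (dimv_leqif_eq M'M) pM'.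
have unitM' w : w \in M' -> rho 1 w = w by move=> wM'; apply/unitM/(subvP M'M).
have [n dM'] := IH M' (leq_trans ltM' dM) sM' unitM'.
exists (fun k' => n k' + (k' == k))%N; rewrite dMM' dM'.
under [RHS]eq_bigr => k' _ do rewrite mulnDl.
rewrite big_split /= [in RHS](bigD1 (F := fun k' => ((k' == k) * _)%N) k) //=.
rewrite eqxx mul1n [X in (_ + (_ + X))%N]big1 ?addn0 // => k' /negPf ->.
by rewrite mul0n.
Qed.

End Modules.

(** * From a Wedderburn decomposition of C^ss to row modules over [C] *)

Lemma wedderburn_morphism (F : fieldType) (C : falgType F) (t : nat)
    (m : 'I_t -> nat) (D : 'I_t -> falgType F) :
    wedderburn_decomposition (ss_quotient C) m D ->
  exists g : {lrmorphism C -> {dffun forall k : 'I_t, mat_alg (m k) (D k)}},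
    (forall p, exists x, g x = p) /\
    (forall x, g x = 0 -> x \in @jacobson_rad F C).
Proof.
case=> _ _ [f f_bij]; pose P := {dffun forall k : 'I_t, mat_alg (m k) (D k)}.
have pi_lin : linear (@ss_pi F C).
  move=> a x y; rewrite ss_piD; congr (_ + _).
  exact/esym/ss_pi_scale.
have pi_mul : monoid_morphism (@ss_pi F C).
  by split=> // x y; exact/esym/ss_pi_mul.
pose piL := GRing.isLinear.Build F C (ss_quotient C) *:%R (@ss_pi F C) pi_lin.
pose piM := GRing.isMonoidMorphism.Build C (ss_quotient C) (@ss_pi F C) pi_mul.
pose p : {lrmorphism C -> ss_quotient C} := HB.pack (@ss_pi F C) piL piM.
exists (f \o p : {lrmorphism C -> P}); split=> [q | x /= fx0].
  have [f' _ ff'] := f_bij; exists (ss_repr (f' q)).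
  by rewrite /= ss_reprK ff'.
have /eqP : ss_pi x = ss_pi 0.
  by apply: (bij_inj f_bij); rewrite fx0 [ss_pi 0]ss_pi0 linear0.
by rewrite ss_pi_eq subr0.
Qed.

Lemma bilinear_End (F : fieldType) (C : lmodType F) (W : vectType F)
    (act : C -> W -> W) :
    (forall x, linear (act x)) -> (forall w, linear (act^~ w)) ->
  exists rho : {linear C -> 'End(W)}, forall x w, rho x w = act x w.
Proof.
move=> act_r act_l.
have actM x := GRing.isLinear.Build F W W *:%R (act x) (act_r x).
pose act' x : {linear W -> W} := HB.pack (act x) (actM x).
pose f x : 'End(W) := linfun (act' x).
have f_lin : linear f.
  move=> a x y; apply/lfunP => w.
  by rewrite add_lfunE scale_lfunE !lfunE /= act_l.
pose fM := GRing.isLinear.Build F C 'End(W) *:%R f f_lin.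
by exists (HB.pack f fM : {linear C -> 'End(W)}) => x w; rewrite /= lfunE.
Qed.

Definition right_module (F : fieldType) (C : falgType F) (W : vectType F)
    (rho : {linear C -> 'End(W)}) : Prop :=
  (forall x y w, rho (x * y) w = rho y (rho x w)) /\ (forall w, rho 1 w = w).

Lemma row_module (F : fieldType) (C : falgType F) (t : nat) (m : 'I_t -> nat)
    (D : 'I_t -> falgType F)
    (g : {lrmorphism C -> {dffun forall k : 'I_t, mat_alg (m k) (D k)}}) k :
  exists rho : {linear C -> 'End({ffun 'I_(m k) -> D k})}, right_module rho.
Proof.
have [||rho rhoE] := @bilinear_End F C {ffun 'I_(m k) -> D k}
  (fun x r => act_row r (g x k)).
- move=> x a r r'; apply/ffunP => j; rewrite !ffunE scaler_sumr -big_split.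
  by apply: eq_bigr => b _; rewrite !ffunE mulrDl scalerAl.
- move=> r a x y; apply/ffunP => j; rewrite linearP !ffunE scaler_sumr -big_split.
  by apply: eq_bigr => b _; rewrite !mxE mulrDr scalerAr.
exists rho; split=> [x y w | w]; rewrite !rhoE.
  by rewrite rmorphM ffunE act_rowM.
by rewrite rmorph1 ffunE act_row1.
Qed.

(** * Modules over a division algebra are free *)

Section DivisionModules.
Variables (F : fieldType) (D : falgType F) (W : vectType F).
Hypothesis D_div : division_algebra D.
Variable rho : {linear D -> 'End(W)}.
Hypothesis rho_mod : right_module rho.

Definition combination n (w : 'I_n -> W) (v : {ffun 'I_n -> D}) : W :=
  \sum_i rho (v i) (w i).

Fact combination_linear n (w : 'I_n -> W) : linear (combination w).
Proof.
move=> a u v; rewrite /combination scaler_sumr -big_split.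
by apply: eq_bigr => i _; rewrite !ffunE linearP add_lfunE scale_lfunE.
Qed.
HB.instance Definition _ n (w : 'I_n -> W) :=
  GRing.isLinear.Build F {ffun 'I_n -> D} W *:%R (combination w)
    (combination_linear w).

Lemma combinationM n (w : 'I_n -> W) (v : {ffun 'I_n -> D}) d :
  combination w [ffun i => v i * d] = rho d (combination w v).
Proof.
have [rhoM _] := rho_mod.
by rewrite linear_sum; apply: eq_bigr => i _; rewrite ffunE rhoM.
Qed.

(** An independent family of maximal length is a basis. Lengths are bounded by [dim W], since n
    independent vectors span n [D:F] dimensions over F. *)
Lemma free_division_module :
  exists n, exists2 w : 'I_n -> W, bijective (combination w)
    & dim W = (n * \dim {:D})%N.
Proof.
have [rhoM rho1] := rho_mod.
pose indep n (w : 'I_n -> W) := forall v, combination w v = 0 -> v = 0.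
have ker_indep n (w : 'I_n -> W) : indep n w -> lker (linfun (combination w)) = 0%VS.
  move=> iw; apply/eqP; rewrite -subv0; apply/subvP => v.
  by rewrite memv_ker lfunE memv0 => /eqP/iw/eqP.
have dim_indep n (w : 'I_n -> W) : indep n w ->
    \dim (limg (linfun (combination w))) = (n * \dim {:D})%N.
  by move/ker_indep=> kw; rewrite limg_dim_eq ?kw ?capv0 // dimvf dim_row.
pose P n := `[< exists w, indep n w >].
have P0 : exists n, P n.
  by exists 0%N; apply/asboolP; exists (fun=> 0) => v _; apply/ffunP; case.
have Pb n : P n -> (n <= dim W)%N.
  move=> /asboolP[w iw]; have := dimvS (subvf (limg (linfun (combination w)))).
  rewrite dimvf; apply: leq_trans.
  by rewrite dim_indep // leq_pmulr // dim_falg_gt0.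
have [n /asboolP[w iw] maxn] := ex_maxnP P0 Pb.
have w_full : limg (linfun (combination w)) = fullv.
  apply: contrapT => /eqP nf; have /subvPn[u _ uw] :
      ~~ (fullv <= limg (linfun (combination w)))%VS.
    by apply: contra nf => fw; rewrite eqEsubv subvf.
  suff /maxn : P n.+1 by rewrite ltnn.
  apply/asboolP; exists (fun i => if unlift ord0 i is Some j then w j else u) => v.
  rewrite /combination big_ord_recl unlift_none => v0.
  pose v' : {ffun 'I_n -> D} := [ffun j => v (lift ord0 j)].
  have {}v0 : rho (v ord0) u + combination w v' = 0.
    rewrite -[RHS]v0; congr (_ + _); apply: eq_bigr => j _.
    by rewrite liftK ffunE.
  (* A nonzero coefficient of u is invertible, and solving the relation for u would put u in the
     span of [w]. *)
  have v00 : v ord0 = 0.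
    apply: contraNeq uw => v00; have /D_div : v ord0 != 0 := v00; move/divrr=> vV.
    rewrite -(rho1 u) -vV rhoM; move/eqP: v0; rewrite addr_eq0 => /eqP->.
    rewrite linearN rpredN /= -combinationM; apply/memv_imgP.
    by exists [ffun i => v' i * (v ord0)^-1]; rewrite ?memvf // lfunE.
  move: v0; rewrite v00 linear0 zero_lfunE add0r => /iw v'0.
  apply/ffunP => i; rewrite [in RHS]ffunE; case: (unliftP ord0 i) => [j -> | -> //].
  by move/ffunP/(_ j): v'0; rewrite !ffunE.
exists n, w; last by rewrite -dimvf -w_full dim_indep.
have kw := ker_indep _ _ iw.
exists (linfun (combination w))^-1%VF => x.
  by rewrite -[combination w x]lfunE lker0_lfunK // kw.
by rewrite -[LHS]lfunE limg_lfunVK // w_full memvf.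
Qed.

End DivisionModules.

Lemma dvdn_division_module (F : fieldType) (D : falgType F) (W : vectType F)
    (rho : {linear D -> 'End(W)}) :
  division_algebra D -> right_module rho -> (\dim {:D} %| dim W)%N.
Proof.
by move=> D_div /(free_division_module D_div)[n [w _ ->]]; apply: dvdn_mull.
Qed.

(** * Restriction of scalars from D to F *)

Section Coordinates.
Import VectorInternalTheory.
Variables (F : fieldType) (D : falgType F) (V : vectType D^c).
Local Notation n := (dim V).
Local Notation W := {ffun 'I_n -> D}.

(** [V] is typed as a vector space over [D^c]; its underlying F-space is modelled by D^n, on which D
    acts by right multiplication of the coordinates. *)
Definition coords (v : V) : W := [ffun i => v2r v 0 i].
Definition of_coords (r : W) : V := r2v (\row_i (r i : D^c)).

Lemma coordsK : cancel coords of_coords.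
Proof.
move=> v; apply: v2r_inj; rewrite r2vK; apply/rowP => i.
by rewrite mxE ffunE.
Qed.
Lemma of_coordsK : cancel of_coords coords.
Proof. by move=> r; apply/ffunP => i; rewrite ffunE r2vK mxE. Qed.

Lemma coordsD : {morph coords : u v / u + v}.
Proof. by move=> u v; apply/ffunP => i; rewrite !ffunE linearD mxE. Qed.
Lemma coords0 : coords 0 = 0.
Proof. by apply: (addrI (coords 0)); rewrite -coordsD !addr0. Qed.
Lemma coordsZ (d : D^c) v : coords (d *: v) = [ffun i => coords v i * (d : D)].
Proof. by apply/ffunP => i; rewrite !ffunE linearZ mxE. Qed.
Lemma of_coordsD : {morph of_coords : u v / u + v}.
Proof. by move=> u v; apply: (can_inj coordsK); rewrite coordsD !of_coordsK. Qed.
Lemma of_coordsZ (d : D) (r : W) :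
  of_coords [ffun i => r i * d] = (d : D^c) *: of_coords r.
Proof. by apply: (can_inj coordsK); rewrite coordsZ !of_coordsK. Qed.

Lemma scale_coords (a : F) (r : W) : a *: r = [ffun i => r i * a%:A].
Proof. by apply/ffunP => i; rewrite !ffunE mulr_algr. Qed.

(** The faithful F-linear representation of End_D(V) on D^n, by transport along [coords]. *)
Lemma restrict_scalars :
  exists K : {linear end_alg V -> 'End(W)},
    [/\ forall (f : end_alg V) r, K f r = coords ((f : 'End(V)) (of_coords r)),
        forall f g r, K (f * g) r = K f (K g r),
        forall r, K 1 r = r &
        forall f, (forall r, K f r = 0) -> f = 0].
Proof.
have [||K KE] := @bilinear_End F (end_alg V) W
  (fun f r => coords ((f : 'End(V)) (of_coords r))).
- move=> f a r r'; rewrite of_coordsD scale_coords of_coordsZ linearD linearZ /=.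
  by rewrite coordsD coordsZ scale_coords.
- move=> r a f g; rewrite add_lfunE coordsD; congr (_ + _).
  by rewrite [(a *: f : 'End(V)) _]end_scaleE coordsZ scale_coords.
exists K; split=> [||r|f f0]; first exact: KE.
- by move=> f g r; rewrite !KE coordsK comp_lfunE.
- by rewrite KE id_lfunE of_coordsK.
apply/lfunP => v; apply: (can_inj coordsK).
by rewrite zero_lfunE coords0 -[v]coordsK -KE.
Qed.

End Coordinates.

(** * (D, A)-bimodules as right modules over the tensor product of D and A^o *)

Section Bimodules.
Variables (F : fieldType) (D A : falgType F) (W : vectType F).
Variables (ra : {linear D -> 'End(W)}) (la : {linear A -> 'End(W)}).

Definition bimodule : Prop :=
  [/\ right_module ra,
      forall a b w, la (a * b) w = la a (la b w),
      forall w, la 1 w = w &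
      forall d a w, ra d (la a w) = la a (ra d w)].

(* Stated for a possibly non-unital left action: a factor of an algebra acting on
   W acts on W with its identity a projection. *)
Lemma tensor_module :
    right_module ra ->
    (forall a b w, la (a * b) w = la a (la b w)) ->
    (forall d a w, ra d (la a w) = la a (ra d w)) ->
  exists rho : {linear tensor_alg D A^c -> 'End(W)},
    (forall x y w, rho (x * y) w = rho y (rho x w)) /\
    (forall d a w, rho (tens d (a : A^c)) w = ra d (la a w)).
Proof.
move=> [raM ra1] laM comm.
have [||rho rhoE _] := @tens_univ F D A^c 'End(W) (fun d a => (ra d \o la a)%VF).
- move=> a k d d'; apply/lfunP => w.
  by rewrite comp_lfunE linearP !add_lfunE !scale_lfunE !comp_lfunE.
- move=> d k a a'; apply/lfunP => w.
  rewrite add_lfunE scale_lfunE !comp_lfunE.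
  rewrite (_ : la (k *: a + a') = k *: la a + la a'); last exact: (linearP la).
  by rewrite add_lfunE scale_lfunE linearP.
exists rho; split=> [x y w | d a w]; last by rewrite rhoE comp_lfunE.
elim/tens_ind: x => [|x x' IH IH'|d a].
- by rewrite mul0r linear0 !zero_lfunE linear0.
- by rewrite mulrDl linearD !add_lfunE IH IH' linearD add_lfunE [RHS]linearD.
elim/tens_ind: y => [|y y' IH IH'|e b].
- by rewrite mulr0 linear0 !zero_lfunE.
- by rewrite mulrDr linearD !add_lfunE IH IH' linearD add_lfunE.
rewrite tens_mul !rhoE !comp_lfunE raM.
(* The product [a * b] is taken in [A^c]; its reversal is what makes the left action of A a right
   action of A^o. *)
by rewrite (_ : la (a * b) = la ((b : A) * (a : A))) // laM -!comm.
Qed.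

Lemma bimodule_of_tensor (rho : {linear tensor_alg D A^c -> 'End(W)}) :
    right_module rho ->
    (forall d w, ra d w = rho (tens d 1) w) ->
    (forall a w, la a w = rho (tens 1 (a : A^c)) w) ->
  bimodule.
Proof.
move=> [rhoM rho1] raE laE; split.
- split=> [d e w | w]; last by rewrite raE tens_one rho1.
  by rewrite !raE -rhoM tens_mul mulr1.
- by move=> a b w; rewrite !laE -rhoM tens_mul mulr1.
- by move=> w; rewrite laE tens_one rho1.
by move=> d a w; rewrite !raE !laE -!rhoM !tens_mul !mul1r !mulr1.
Qed.

End Bimodules.

(* N is the dimension of a (D, A)-bimodule whose annihilator in A satisfies Z. *)
Definition realizes (F : fieldType) (D A : falgType F) (Z : A -> Prop)
    (N : nat) : Prop :=
  exists (W : vectType F) (ra : {linear D -> 'End(W)}) (la : {linear A -> 'End(W)}),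
    [/\ bimodule ra la, dim W = N & forall a, (forall w, la a w = 0) -> Z a].

(** * Dimensions and annihilators of bimodules under direct sums *)

Section Realizes.
Variables (F : fieldType) (D A : falgType F).
Implicit Types Z : A -> Prop.

Lemma realizes_weaken Z Z' N :
  (forall a, Z a -> Z' a) -> realizes D Z N -> realizes D Z' N.
Proof.
by move=> ZZ' [W [ra [la [bim dW WZ]]]]; exists W, ra, la; split=> // a /WZ/ZZ'.
Qed.

(** All of A annihilates the zero bimodule, hence the condition on [Z]. *)
Lemma realizes0 Z : (forall a, Z a) -> realizes D Z 0.
Proof.
move=> allZ; exists 'rV[F]_0, \0, \0; split=> //.
by do ?split=> * /=; rewrite ?zero_lfunE; apply/rowP; case.
Qed.

Lemma pair_End (C : lmodType F) (W W' : vectType F)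
    (rho : {linear C -> 'End(W)}) (rho' : {linear C -> 'End(W')}) :
  exists sigma : {linear C -> 'End((W * W')%type)},
    forall x w, sigma x w = (rho x w.1, rho' x w.2).
Proof.
apply: bilinear_End => [x a u v | w a x y] /=.
  by rewrite !linearP; congr (_, _).
by rewrite !linearP !add_lfunE !scale_lfunE.
Qed.

(** Direct sum of bimodules: an element kills the sum iff it kills both summands. *)
Lemma realizesD Z Z' N N' :
  realizes D Z N -> realizes D Z' N' ->
  realizes D (fun a => Z a /\ Z' a) (N + N').
Proof.
move=> [W [ra [la [[[raM ra1] laM la1 comm] dW WZ]]]].
move=> [W' [ra' [la' [[[ra'M ra'1] la'M la'1 comm'] dW' WZ']]]].
have [sa saE] := pair_End ra ra'; have [ka kaE] := pair_End la la'.
exists (W * W')%type, sa, ka; split=> [||a a0]; last 1 first.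
- split; [apply: WZ => w; have := a0 (w, 0) | apply: WZ' => w; have := a0 (0, w)].
    by rewrite kaE => -[].
  by rewrite kaE => -[].
- split=> [|a b [w w']|[w w']|d a [w w']].
  + split=> [x y [w w']|[w w']]; first by rewrite !saE /= raM ra'M.
    by rewrite saE /= ra1 ra'1.
  + by rewrite !kaE /= laM la'M.
  + by rewrite kaE /= la1 la'1.
  by rewrite !(saE, kaE) /= comm comm'.
by rewrite -dW -dW'.
Qed.

Lemma realizes_sum (I : finType) (Z : I -> A -> Prop) (N : I -> nat) :
  (forall i, realizes D (Z i) (N i)) ->
  realizes D (fun a => forall i, Z i a) (\sum_i N i).
Proof.
move=> ZN; suff sum_r (r : seq I) :
    realizes D (fun a => forall i, i \in r -> Z i a) (\sum_(i <- r) N i).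
  apply: realizes_weaken (sum_r (index_enum I)) => a + i.
  by apply; rewrite mem_index_enum.
elim: r => [|i r IH]; first by rewrite big_nil; apply: realizes0.
rewrite big_cons; apply: realizes_weaken (realizesD (ZN i) IH) => a [Zi Zr] k.
by rewrite inE => /predU1P[-> | /Zr].
Qed.

Lemma realizes_muln Z n N :
  (0 < n)%N -> realizes D Z N -> realizes D Z (n * N).
Proof.
move=> n0 ZN; have := @realizes_sum 'I_n (fun=> Z) (fun=> N) (fun=> ZN).
rewrite sum_nat_const card_ord; apply: realizes_weaken => a.
exact: (@^~ (Ordinal n0)).
Qed.

Lemma realizes_dvdn Z N :
  division_algebra D -> realizes D Z N -> (\dim {:D} %| N)%N.
Proof.
by move=> D_div [W [ra [la [[raM _ _ _] <- _]]]]; apply: dvdn_division_module raM.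
Qed.

(** The kernel of the action is a two-sided ideal, and it is proper because 1 acts as the identity
    on a nonzero space. *)
Lemma realizes_simple Z N :
    simple_algebra A -> (0 < N)%N -> realizes D Z N ->
  realizes D (fun a : A => a = 0) N.
Proof.
move=> A_simple N0 [W [ra [la [bim dW WZ]]]]; exists W, ra, la; split=> // a a0.
have [_ laM la1 _] := bim.
have memK b : (b \in lker (linfun la)) <-> (forall w, la b w = 0).
  rewrite memv_ker lfunE /=; split=> [/eqP-> w | b0]; first exact: zero_lfunE.
  by apply/eqP/lfunP => w; rewrite b0 zero_lfunE.
have [|K0|KT] := A_simple (lker (linfun la)).
- split=> [b c | b c] /memK c0; apply/memK => w; rewrite laM ?c0 //.
  exact: linear0.
- by have /memK := a0; rewrite K0 memv0 => /eqP.
have /memK l1 : 1 \in lker (linfun la) by rewrite KT memvf.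
move: N0; rewrite -dW -dimvf lt0n dimv_eq0 => /eqP[].
by apply/vspaceP => w; rewrite memvf memv0 -(la1 w) l1 eqxx.
Qed.

End Realizes.

(** * Passage between bimodules and divisibility counts *)

Lemma realizes_pullback (F : fieldType) (D A A' : falgType F)
    (p : {linear A -> A'}) (Z : A' -> Prop) (N : nat) :
    p 1 = 1 -> {morph p : a b / a * b} ->
    realizes D Z N -> realizes D (fun a => Z (p a)) N.
Proof.
move=> p1 pM [W [ra [la [[raM laM la1 comm] dW WZ]]]].
exists W, ra, (la \o p); split=> //= [|a]; last exact: WZ.
by split=> //= [a b w | w]; rewrite ?pM ?p1.
Qed.

Lemma realizes_factor (F : fieldType) (D A : falgType F) (t : nat)
    (m : 'I_t -> nat) (E : 'I_t -> falgType F) (k : 'I_t) :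
    wedderburn_decomposition (ss_quotient (tensor_alg D A^c)) m E ->
  realizes (A := A) D (fun=> True) (m k * \dim {:E k}).
Proof.
move=> /wedderburn_morphism[g _]; have [rho rho_mod] := row_module g k.
have [||ra raE] := @bilinear_End F D _ (fun d w => rho (tens d (1 : A^c)) w).
- by move=> d; apply: linearP.
- by move=> w a d d'; rewrite tensDl tensZl linearP add_lfunE scale_lfunE.
have [||la laE] := @bilinear_End F A _ (fun a w => rho (tens 1 (a : A^c)) w).
- by move=> a; apply: linearP.
- move=> w a b c; rewrite -[in RHS]scale_lfunE -[in RHS]add_lfunE -linearP.
  by rewrite -tensZr -tensDr.
exists {ffun 'I_(m k) -> E k}, ra, la; split; [|exact: dim_row|by []].
exact: (@bimodule_of_tensor F D A _ ra la rho).
Qed.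

(** With x_k = q_k (m_k [E_k:F] / [D:F]), the direct sum of q_k copies of each k-th row module has
    the required dimension. *)
Lemma realizes_of_counts (F : fieldType) (D A : falgType F) (t : nat)
    (m : 'I_t -> nat) (E : 'I_t -> falgType F) (x : 'I_t -> nat) :
    division_algebra D ->
    wedderburn_decomposition (ss_quotient (tensor_alg D A^c)) m E ->
    (forall k, (m k * \dim {:E k}) %/ \dim {:D} %| x k)%N ->
  realizes (A := A) D (fun=> True) ((\sum_k x k) * \dim {:D}).
Proof.
move=> D_div wed dvd_x; rewrite big_distrl /=.
apply: realizes_weaken (realizes_sum (Z := fun=> fun=> True) _) => // k.
have Rk := realizes_factor k wed; have /dvdnP[q ->] := dvd_x k.
(* The quotient is exact because the row module is free over D. *)
rewrite -mulnA divnK; last exact: realizes_dvdn Rk.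
by case: q => [|q]; [apply: realizes0 | apply: realizes_muln].
Qed.

(** The left action may be non-unital: [la 1] is then a projection, and its image is a unital module
    over the tensor product, to which [dim_module] applies. *)
Lemma counts_of_bimodule (F : fieldType) (D A : falgType F) (t : nat)
    (m : 'I_t -> nat) (E : 'I_t -> falgType F) (W : vectType F)
    (ra : {linear D -> 'End(W)}) (la : {linear A -> 'End(W)}) :
    division_algebra D ->
    wedderburn_decomposition (ss_quotient (tensor_alg D A^c)) m E ->
    right_module ra -> (forall a b w, la (a * b) w = la a (la b w)) ->
    (forall d a w, ra d (la a w) = la a (ra d w)) ->
  exists x : 'I_t -> nat,
    (forall k, (m k * \dim {:E k}) %/ \dim {:D} %| x k)%N /\
    ((\sum_k x k) * \dim {:D})%N = \dim (limg (la 1)).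
Proof.
move=> D_div wed ra_mod laM comm; have [raM ra1] := ra_mod.
have [rho [rhoM rhoE]] := tensor_module ra_mod laM comm.
have [g [g_surj g_ker]] := wedderburn_morphism wed.
have rho1 w : rho 1 w = la 1 w by rewrite -tens_one rhoE ra1.
have stM : stable rho (limg (la 1)).
  move=> x _ /memv_imgP[w _ ->]; apply/memv_imgP; exists (rho x w).
    exact: memvf.
  by rewrite -!rho1 -!rhoM mulr1 mul1r.
have unitM w : w \in limg (la 1) -> rho 1 w = w.
  by case/memv_imgP=> u _ ->; rewrite rho1 -laM mulr1.
have E_div k : division_algebra (E k) by case: wed.
have [n dM] := dim_module rhoM E_div g_surj g_ker stM unitM.
exists (fun k => n k * ((m k * \dim {:E k}) %/ \dim {:D}))%N; split=> [k|].
  exact: dvdn_mull.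
rewrite dM big_distrl; apply: eq_bigr => k _ /=; rewrite -mulnA divnK //.
exact: realizes_dvdn D_div (realizes_factor k wed).
Qed.

(** Orthogonal idempotents with sum 1 decompose the space as the direct sum of their images. *)
Lemma sum_dim_limg_idempotents (F : fieldType) (W : vectType F) (s : nat)
    (e : 'I_s -> 'End(W)) :
    (forall i j w, e i (e j w) = if i == j then e i w else 0) ->
    (forall w, \sum_i e i w = w) ->
  (\sum_i \dim (limg (e i)) = dim W)%N.
Proof.
move=> eM e1.
have dir : directv (\sum_i limg (e i)).
  apply/directv_sum_independent => us Uu us0 i _.
  have usE j : exists w, us j = e j w.
    by have /memv_imgP[w _ ->] := Uu j isT; exists w.
  have eus j : e i (us j) = if i == j then us j else 0.
    have [w ->] := usE j; rewrite eM; by have [->|] := eqVneq.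
  have := congr1 (e i) us0; rewrite linear0 linear_sum (bigD1 i) //= eus eqxx.
  by rewrite big1 ?addr0 // => j ji; rewrite eus eq_sym (negPf ji).
rewrite -(directvP dir) /= -dimvf; congr (\dim _).
apply/vspaceP => w; rewrite memvf -(e1 w) memv_sumr // => i _.
by rewrite memv_img ?memvf.
Qed.

(** * Homomorphisms A -> End_D(V) and bimodules *)

Section EndomorphismRings.
Variables (F : fieldType) (D : falgType F) (V : vectType D^c) (A : falgType F).

Lemma realizes_of_hom (h : {lrmorphism A -> end_alg V}) :
  realizes D (fun a => h a = 0) (dim V * \dim {:D}).
Proof.
have [K [KE KM K1 K0]] := restrict_scalars V.
pose W : vectType F := {ffun 'I_(dim V) -> D}.
have [||ra raE] := @bilinear_End F D W (fun d r => [ffun i => r i * d]).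
- by move=> d a r r'; apply/ffunP => i; rewrite !ffunE mulrDl scalerAl.
- by move=> r a d e; apply/ffunP => i; rewrite !ffunE mulrDr scalerAr.
exists W, ra, (K \o h); split=> [||a a0]; [|exact: dim_row|exact: K0].
split=> /= [|a b r|r|d a r].
- split=> [d e r | r]; rewrite !raE; apply/ffunP => i; rewrite !ffunE.
    by rewrite mulrA.
  by rewrite mulr1.
- by rewrite rmorphM KM.
- by rewrite rmorph1 K1.
by rewrite !raE !KE of_coordsZ linearZ /= coordsZ.
Qed.

(** As a right D-module the bimodule is free, and its F-dimension makes its rank [dim V]; the action
    of A is transported to [V] along the resulting isomorphism. *)
Lemma hom_of_realizes (Z : A -> Prop) :
    division_algebra D -> realizes D Z (dim V * \dim {:D}) ->
  exists h : {lrmorphism A -> end_alg V}, forall a, h a = 0 -> Z a.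
Proof.
move=> D_div [W [ra [la [[ra_mod laM la1 comm] dW WZ]]]].
have [n [w [T' TK TK'] dW']] := free_division_module D_div ra_mod.
have nV : n = dim V.
  by apply/eqP; rewrite -(eqn_pmul2r (dim_falg_gt0 D)) -dW' dW.
subst n; set T := combination ra w in TK TK'.
have T'D u v : T' (u + v) = T' u + T' v.
  by apply: (can_inj TK); rewrite /T linearD /= -/T !TK'.
(* D-linearity of the inverse isomorphism; with [comm] it makes the transported action D-linear. *)
have T'M d v : T' (ra d v) = [ffun i => T' v i * d].
  by apply: (can_inj TK); rewrite TK' /T combinationM // -/T TK'.
pose f a (v : V) : V := of_coords (T' (la a (T (coords v)))).
have f_lin a : linear (f a).
  move=> d u v; rewrite /f coordsD coordsZ /T linearD /= combinationM // -/T.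
  by rewrite linearD /= -comm T'D T'M of_coordsD of_coordsZ.
pose fM a := GRing.isLinear.Build D^c V V *:%R (f a) (f_lin a).
pose f' a : {linear V -> V} := HB.pack (f a) (fM a).
pose h a : end_alg V := linfun (f' a).
have hE a v : (h a : 'End(V)) v = f a v by rewrite lfunE.
have h_lin : linear h.
  move=> k a b; apply/lfunP => v; rewrite hE add_lfunE.
  rewrite [(k *: h a : 'End(V)) v]end_scaleE !hE /f linearP add_lfunE scale_lfunE.
  rewrite T'D of_coordsD; congr (_ + _); rewrite -of_coordsZ; congr of_coords.
  rewrite -T'M; congr (T' _); have [raM ra1] := ra_mod.
  by rewrite linearZ /= scale_lfunE ra1.
have h_mul : monoid_morphism h.
  split=> [|a b]; apply/lfunP => v.
    by rewrite hE /f la1 TK coordsK id_lfunE.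
  by rewrite comp_lfunE !hE /f laM of_coordsK TK'.
pose hL := GRing.isLinear.Build F A (end_alg V) *:%R h h_lin.
pose hM := GRing.isMonoidMorphism.Build A (end_alg V) h h_mul.
exists (HB.pack h hL hM : {lrmorphism A -> end_alg V}) => /= a h0.
apply: WZ => u; have := congr1 (fun g : 'End(V) => g (of_coords (T' u))) h0.
rewrite hE /f of_coordsK TK' zero_lfunE => fu0.
rewrite -[LHS]TK' -[T' _]of_coordsK fu0 coords0.
by rewrite /T linear0.
Qed.

End EndomorphismRings.

(** * Homomorphisms into a product of endomorphism algebras, one component at a time *)

Section Products.
Variables (F : fieldType) (A B : falgType F).
Variables (r : nat) (Delta : 'I_r -> falgType F).
Variables (V : forall j : 'I_r, vectType (Delta j)^c).
Variable phi : {lrmorphism B -> {dffun forall j : 'I_r, end_alg (V j)}}.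

Lemma hom_component (f : {lrmorphism A -> B}) j :
  exists h : {lrmorphism A -> end_alg (V j)}, forall a, h a = phi (f a) j.
Proof.
pose h a : end_alg (V j) := phi (f a) j.
have h_lin : linear h by move=> k a b; rewrite /h !linearP !ffunE.
have h_mul : monoid_morphism h.
  by split=> [|a b]; rewrite /h !(rmorph1, rmorphM) ffunE.
pose hL := GRing.isLinear.Build F A (end_alg (V j)) *:%R h h_lin.
pose hM := GRing.isMonoidMorphism.Build A (end_alg (V j)) h h_mul.
by exists (HB.pack h hL hM : {lrmorphism A -> end_alg (V j)}).
Qed.

Lemma hom_of_components (h : forall j, {lrmorphism A -> end_alg (V j)}) :
    bijective phi ->
  exists f : {lrmorphism A -> B}, forall a j, phi (f a) j = h j a.
Proof.
move=> phi_bij; have [phi' phiK phi'K] := phi_bij.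
pose q a : {dffun forall j, end_alg (V j)} := [ffun j => h j a].
pose f a := phi' (q a).
have phif a : phi (f a) = q a by rewrite phi'K.
have f_lin : linear f.
  move=> k a b; apply: (bij_inj phi_bij); rewrite linearP /= !phif.
  by apply/ffunP => j; rewrite !ffunE linearP.
have f_mul : monoid_morphism f.
  split=> [|a b]; apply: (bij_inj phi_bij); rewrite ?rmorph1 ?rmorphM /= !phif;
    by apply/ffunP => j; rewrite !ffunE ?rmorph1 ?rmorphM.
pose fL := GRing.isLinear.Build F A B *:%R f f_lin.
pose fM := GRing.isMonoidMorphism.Build A B f f_mul.
exists (HB.pack f fL fM : {lrmorphism A -> B}) => a j.
by rewrite [LHS](congr1 (fun p : {dffun forall j, end_alg (V j)} => p j) (phif a)) ffunE.
Qed.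

Lemma hom_of_realizations (Z : 'I_r -> A -> Prop) :
    (forall j, division_algebra (Delta j)) -> bijective phi ->
    (forall j, realizes (Delta j) (Z j) (dim (V j) * \dim {:Delta j})) ->
  exists f : {lrmorphism A -> B}, forall a, f a = 0 -> forall j, Z j a.
Proof.
move=> D_div phi_bij Zj.
pose h j := cid (hom_of_realizes (D_div j) (Zj j)).
have [f fE] := hom_of_components (fun j => projT1 (h j)) phi_bij.
exists f => a fa0 j; apply: (projT2 (h j)).
by rewrite -fE fa0 linear0 ffunE.
Qed.

Lemma realization_of_hom (f : {lrmorphism A -> B}) j :
  realizes (Delta j) (fun a => phi (f a) j = 0) (dim (V j) * \dim {:Delta j}).
Proof.
have [h hE] := hom_component f j.
by apply: realizes_weaken (realizes_of_hom h) => a; rewrite hE.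
Qed.

End Products.

(** Here [la 1] is the identity, so its image is all of [W], and the factor [D:F] cancels. *)
Lemma counts_of_realizes (F : fieldType) (D A : falgType F) (t : nat)
    (m : 'I_t -> nat) (E : 'I_t -> falgType F) (Z : A -> Prop) (v : nat) :
    division_algebra D ->
    wedderburn_decomposition (ss_quotient (tensor_alg D A^c)) m E ->
    realizes D Z (v * \dim {:D}) ->
  exists x : 'I_t -> nat, (\sum_k x k)%N = v /\
    (forall k, (m k * \dim {:E k}) %/ \dim {:D} %| x k)%N.
Proof.
move=> D_div wed [W [ra [la [[ra_mod laM la1 comm] dW _]]]].
have [x [dvd_x sum_x]] := counts_of_bimodule D_div wed ra_mod laM comm.
exists x; split=> //; apply/eqP; rewrite -(eqn_pmul2r (dim_falg_gt0 D)) sum_x -dW.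
rewrite -dimvf; apply/eqP; congr (\dim _); apply/vspaceP => w.
by rewrite memvf -(la1 w) memv_img ?memvf.
Qed.

(** * Bimodules over a product of algebras, split by its central idempotents *)

Section ProductOfAlgebras.
Variables (F : fieldType) (D A : falgType F) (s : nat) (A_ : 'I_s -> falgType F).
Variable psi : {lrmorphism A -> {dffun forall i : 'I_s, A_ i}}.
Hypothesis D_div : division_algebra D.
Variables (t : 'I_s -> nat) (m : forall i, 'I_(t i) -> nat).
Variable E : forall i, 'I_(t i) -> falgType F.
Hypothesis wed : forall i,
  wedderburn_decomposition (ss_quotient (tensor_alg D (A_ i)^c)) (@m i) (@E i).

(** The identities of the factors A_i cut [W] into pieces, and the counts of index i measure the
    i-th piece. If they vanish, so does the piece, and the identity of A_i annihilates [W]. *)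
Lemma counts_of_realizes_prod (Z : A -> Prop) (v : nat) :
    bijective psi -> realizes D Z (v * \dim {:D}) ->
  exists x : forall i, 'I_(t i) -> nat,
    [/\ (\sum_i \sum_(k < t i) x i k)%N = v,
        forall i k, ((m k * \dim {:E k}) %/ \dim {:D} %| x i k)%N &
        forall i a, (\sum_(k < t i) x i k)%N = 0%N -> psi a = single (1 : A_ i) ->
          Z a].
Proof.
move=> psi_bij [W [ra [la [[ra_mod laM la1 comm] dW WZ]]]].
have [psi' psiK psi'K] := psi_bij.
pose inj i (a : A_ i) := psi' (single a).
have inj_lin i : linear (@inj i).
  move=> k a b; apply: (bij_inj psi_bij); rewrite linearP /= !psi'K.
  apply/ffunP => i'; rewrite !ffunE; have [<- | ii'] := eqVneq i i'.
    by rewrite !dfwith_in.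
  by rewrite !dfwith_out // scaler0 addr0.
have injM i a b : inj i (a * b) = inj i a * inj i b.
  apply: (bij_inj psi_bij); rewrite rmorphM /= !psi'K.
  by rewrite single_mulr singleE.
have inj0 i j a b : i != j -> inj i a * inj j b = 0.
  move=> ij; apply: (bij_inj psi_bij); rewrite rmorphM /= !psi'K linear0.
  rewrite single_mulr singleN 1?eq_sym // mulr0.
  apply/ffunP => k; rewrite [RHS]ffunE; have [<- | ik] := eqVneq i k.
    exact: singleE.
  by rewrite singleN.
have inj1 : \sum_i inj i 1 = 1.
  apply: (bij_inj psi_bij); rewrite rmorph1 linear_sum [RHS]sum_single.
  by apply: eq_bigr => i _; rewrite /= psi'K ffunE.
have ex_x i : exists x : 'I_(t i) -> nat,
    (forall k, (m k * \dim {:E k}) %/ \dim {:D} %| x k)%N /\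
    ((\sum_k x k) * \dim {:D})%N = \dim (limg (la (inj i 1))).
  (* The inclusion of A_i does not preserve 1, so A_i acts on all of [W] non-unitally. *)
  pose injL := GRing.isLinear.Build F (A_ i) A *:%R (@inj i) (inj_lin i).
  pose inj' : {linear A_ i -> A} := HB.pack (@inj i) injL.
  apply: (@counts_of_bimodule F D (A_ i) _ _ _ W ra (la \o inj')) => //= a b w.
  by rewrite injM laM.
have /all_sig[x xP] := fun i => cid (ex_x i).
exists x; split=> [|i k|i a xi0 psia]; last 1 first.
- apply: WZ => w; have [_] := xP i; rewrite xi0 mul0n => /esym/eqP.
  rewrite dimv_eq0 => /eqP l0.
  have -> : a = inj i 1 by apply: (bij_inj psi_bij); rewrite psi'K.
  by apply/eqP; rewrite -memv0 -l0 memv_img ?memvf.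
- apply/eqP; rewrite -(eqn_pmul2r (dim_falg_gt0 D)) -dW big_distrl /=.
  under eq_bigr => i _ do rewrite (xP i).2.
  apply/eqP/sum_dim_limg_idempotents => [i j w | w].
    rewrite -laM; have [<- | ij] := eqVneq i j; first by rewrite -injM mulr1.
    by rewrite inj0 // linear0 zero_lfunE.
  by rewrite -[RHS]la1 -inj1 linear_sum sum_lfunE.
by have [] := xP i.
Qed.

(** Bimodules over the A_i are pulled back along the projections from A and summed. A nonzero
    summand is faithful over the simple algebra A_i, which gives the stated annihilator. *)
Lemma realizes_of_counts_prod (x : forall i, 'I_(t i) -> nat) :
    (forall i, simple_algebra (A_ i)) ->
    (forall i k, ((m k * \dim {:E k}) %/ \dim {:D} %| x i k)%N) ->
  realizes D
    (fun a => forall i, (0 < \sum_(k < t i) x i k)%N -> psi a i = 0)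
    ((\sum_i \sum_(k < t i) x i k) * \dim {:D}).
Proof.
move=> A_simple dvd_x; rewrite big_distrl /=; apply: realizes_sum => i.
have R := realizes_of_counts D_div (wed i) (dvd_x i).
pose p a := psi a i.
have p_lin : linear p by move=> k a b; rewrite /p linearP !ffunE.
pose pL := GRing.isLinear.Build F A (A_ i) *:%R p p_lin.
pose p' : {linear A -> A_ i} := HB.pack p pL.
have p1 : p' 1 = 1 by rewrite /= /p rmorph1 ffunE.
have pM : {morph p' : a b / a * b} by move=> a b; rewrite /= /p rmorphM ffunE.
have [x0 | ] := posnP (\sum_(k < t i) x i k).
  by apply: realizes_weaken (realizes_pullback p1 pM R).
move=> x0; have N0 : (0 < (\sum_(k < t i) x i k) * \dim {:D})%N.
  by rewrite muln_gt0 x0 dim_falg_gt0.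
by apply: realizes_weaken (realizes_pullback p1 pM (realizes_simple (A_simple i) N0 R)).
Qed.

End ProductOfAlgebras.

Theorem theorem1p2 (F : fieldType) (A B : falgType F)
    (A_ss : semisimple_algebra A) (B_ss : semisimple_algebra B)
    (r : nat) (Delta : 'I_r -> falgType F)
    (Delta_div : forall j, division_algebra (Delta j))
    (V : forall j : 'I_r, vectType (Delta j)^c)
    (phi : {lrmorphism B -> {dffun forall j : 'I_r, end_alg (V j)}})
    (phi_bij : bijective phi)
    (s : nat) (A_ : 'I_s -> falgType F)
    (A_simple : forall i, simple_algebra (A_ i))
    (psi : {lrmorphism A -> {dffun forall i : 'I_s, A_ i}})
    (psi_bij : bijective psi) :
  (forall (t : 'I_r -> nat) (m : forall j, 'I_(t j) -> nat)
      (D : forall j, 'I_(t j) -> falgType F),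
      (forall j, wedderburn_decomposition
                   (ss_quotient (tensor_alg (Delta j) A^c)) (m j) (D j)) ->
    inhabited {lrmorphism A -> B} <->
    exists x : forall j, 'I_(t j) -> nat,
      (forall j, (\sum_(k < t j) x j k)%N = dim (V j)) /\
      (forall j k,
         ((m j k * \dim {: D j k}) %/ \dim {: Delta j} %| x j k)%N)) /\
  (forall (t : 'I_r -> 'I_s -> nat) (m : forall j i, 'I_(t j i) -> nat)
      (D : forall j i, 'I_(t j i) -> falgType F),
      (forall j i, wedderburn_decomposition
                     (ss_quotient (tensor_alg (Delta j) (A_ i)^c))
                     (m j i) (D j i)) ->
    (exists f : {lrmorphism A -> B}, injective f) <->
    exists x : forall j i, 'I_(t j i) -> nat,
      [/\ forall j, (\sum_(i < s) \sum_(k < t j i) x j i k)%N = dim (V j),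
          forall j i k,
            ((m j i k * \dim {: D j i k}) %/ \dim {: Delta j} %| x j i k)%N &
          forall i, (0 < \sum_(j < r) \sum_(k < t j i) x j i k)%N]).
Proof.
split=> [t m D wed | t m D wed].
  split=> [[f] | [x [sum_x dvd_x]]].
    have /all_sig[x xP] := fun j => cid (counts_of_realizes (Delta_div j) (wed j)
      (realization_of_hom phi f j)).
    by exists x; split=> j; have [] := xP j.
  (* Part (1) asks nothing of the kernel, so the annihilator condition is trivial. *)
  have [|f _] := hom_of_realizations (A := A) (Z := fun _ _ => True) Delta_div phi_bij.
    by move=> j; rewrite -sum_x; apply: realizes_of_counts.
  by exists.
split=> [[f f_inj] | [x [sum_x dvd_x x_pos]]].
  have /all_sig[x xP] := fun j => cid (counts_of_realizes_prod (Delta_div j)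
    (wed j) psi_bij (realization_of_hom phi f j)).
  exists x; split=> [j|j|i]; try by have [] := xP j.
  (* If all counts for i vanish, the identity [e] of A_i acts as zero on every V_j, so f(e) = 0 and
     injectivity gives e = 0, which is absurd. *)
  rewrite lt0n; apply/eqP => /eqP; rewrite sum_nat_eq0 => /forallP x0.
  have [psi' _ psi'K] := psi_bij; pose e := psi' (single (1 : A_ i)).
  have psie : psi e = single (1 : A_ i) by rewrite psi'K.
  have e0 : e = 0.
    apply: f_inj; apply: (bij_inj phi_bij); rewrite !linear0; apply/ffunP => j.
    have [_ _ /(_ i e)->] := xP j; rewrite ?ffunE //.
    exact/eqP/(implyP (x0 j)).
  have /eqP[] := oner_neq0 (A_ i).
  by rewrite -[LHS](singleE (T := A_)) -psie e0 linear0 ffunE.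
have [|f fP] := hom_of_realizations (A := A) (Z := fun j a =>
  forall i, (0 < \sum_(k < t j i) x j i k)%N -> psi a i = 0) Delta_div phi_bij.
  by move=> j; rewrite -sum_x; apply: realizes_of_counts_prod.
exists f; apply: raddf_inj => a /fP fa0.
apply: (bij_inj psi_bij); rewrite linear0; apply/ffunP => i; rewrite ffunE.
(* By (c) some j has a positive count for i, and its bimodule forces the i-th component of a to
   vanish. *)
have := x_pos i; rewrite lt0n sum_nat_eq0 => /forallPn[j]; rewrite negb_imply /=.
by rewrite -lt0n => /fa0.
Qed.
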